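(* Let $\Lambda$ be a sign-respecting function and let $0<\epsilon<1/2$. There exists $\delta_0=\delta_0(\Lambda,\epsilon)>0$ such that for every $0<\delta\le\delta_0$ there is $N=N(\Lambda,\epsilon,\delta)$ such that for all $n\ge N$ the following holds. For every $0\le\eta<1/2$ and every $\mathbf{p}=(p_1,\dots,p_n),\mathbf{p}'=(p_1',\dots,p_n')\in[\epsilon,1-\epsilon]^n$ with $|p_i-p_i'|\ge\epsilon$ for all $i$, if $\bm\beta^*$ is the risk-minimizing linear solution of $(\mathbf{X},Y)$ for $(\mathbf{X},Y,Z)\sim\mathcal{D}^{\eta}_{\mathbf{p},\mathbf{p}'}$, then $$\mathbb{P}_{(\mathbf{X},Y,Z)\sim\mathcal{D}^{\eta}_{\mathbf{p},\mathbf{p}'}}\Big[R^{\Lambda}_{\mathbf{p},\mathbf{p}'}(\mathbf{X},Z)\le\epsilon\ \Big|\ F(H_{\bm\beta^*}(\mathbf{X}))\ge 1-\delta\Big]\ \ge\ 1-\epsilon,$$ where $F$ is the CDF of $H_{\bm\beta^*}(\mathbf{X})$ under $\mathcal{D}^{\eta}_{\mathbf{p},\mathbf{p}'}$ and $$R^{\Lambda}_{\mathbf{p},\mathbf{p}'}(\mathbf{X},Z)=\mathbf{1}_{Z=1}\,F_{1}\big(\Psi^{\Lambda}_{\mathbf{p},\mathbf{p}'}(\mathbf{X})\big)+\mathbf{1}_{Z=-1}\,F_{2}\big(\Psi^{\Lambda}_{\mathbf{p}',\mathbf{p}}(\mathbf{X})\big),$$ with $F_1$ the CDF of $\Psi^{\Lambda}_{\mathbf{p},\mathbf{p}'}(\mathbf{X}')$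 for $\mathbf{X}'\sim\mathcal{B}_{\mathbf{p}}$ and $F_2$ the CDF of $\Psi^{\Lambda}_{\mathbf{p}',\mathbf{p}}(\mathbf{X}')$ for $\mathbf{X}'\sim\mathcal{B}_{\mathbf{p}'}$.
   Context: For $\mathbf{q}\in[0,1]^n$, $\mathcal{B}_{\mathbf{q}}$ is the law of independent $X_i\in\{-1,1\}$ with $\mathbb{P}[X_i=1]=q_i$. The toy distribution $\mathcal{D}^{\eta}_{\mathbf{p},\mathbf{p}'}$: sample $Z$ uniformly from $\{-1,1\}$; if $Z=1$ sample $\mathbf{X}\sim\mathcal{B}_{\mathbf{p}}$, else $\mathbf{X}\sim\mathcal{B}_{\mathbf{p}'}$; set $Y=Z$ with probability $1-\eta$ and $Y=-Z$ with probability $\eta$. The risk-minimizing linear solution is $\bm\beta^*=(\beta_0,\dots,\beta_n)=\arg\min_{\bm\beta}\mathbb{E}(\beta_0+\sum_i\beta_iX_i-Y)^2$ (it is unique under the stated hypotheses). Entropy function: for $\bm\beta\in\mathbb{R}^{n+1}$, $H_{\bm\beta}(x_1,\dots,x_n)=H\big(\frac{e^{s}}{1+e^{s}}\big)$ with $s=\beta_0+\sum_{i=1}^n\beta_ix_i$ and $H(q)=-q\log q-(1-q)\log(1-q)$. A function $\Lambda$ defined on $\{(q,q')\in[0,1]^2: q\ne q'\}$ is sign-respecting if it is continuous on each of $A_+=\{q>q'\}$ and $A_-=\{q<q'\}$, positive on $A_+$ and negative on $A_-$. Spurious cue score: $\Psi^{\Lambda}_{\mathbf{p},\mathbf{p}'}(\mathbf{x})=\sum_{i=1}^n\Lambda(p_i,p_i')x_i$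 (and $\Psi^{\Lambda}_{\mathbf{p}',\mathbf{p}}(\mathbf{x})=\sum_i\Lambda(p_i',p_i)x_i$). For a random variable $V$ with a specified law, its CDF is $F_V(v)=\mathbb{P}[V\le v]$ and $F(V)$ means this CDF evaluated at $V$. *)

(* Defs.v *)
From HB Require Import structures.
From mathcomp Require Import all_boot all_order all_algebra.
From mathcomp Require Import all_classical all_reals all_analysis.
Set Implicit Arguments. Unset Strict Implicit. Unset Printing Implicit Defensive.
Import Order.TTheory GRing.Theory Num.Theory.
Import numFieldNormedType.Exports.
Local Open Scope ring_scope.
Local Open Scope classical_set_scope.

Section Toy.
Variable R : realType.

Definition sgnb (b : bool) : R := if b then 1 else -1.

(* sample space of (X, Y, Z): ((x, y), z) *)
Definition omega (n : nat) := ({ffun 'I_n -> bool} * bool * bool)%type.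

Definition bern n (q : 'I_n -> R) (x : {ffun 'I_n -> bool}) : R :=
  \prod_(i < n) (if x i then q i else 1 - q i).

(* mass of D^eta_{p,p'} : Z uniform, X | Z, Y = Z w.p. 1 - eta *)
Definition toy_mass n (eta : R) (p p' : 'I_n -> R) (w : omega n) : R :=
  (1 / 2) * (if w.2 then bern p w.1.1 else bern p' w.1.1)
          * (if w.1.2 == w.2 then 1 - eta else eta).

Definition toy_prob n eta (p p' : 'I_n -> R) (A : pred (omega n)) : R :=
  \sum_(w : omega n | A w) toy_mass eta p p' w.

Definition toy_expect n eta (p p' : 'I_n -> R) (f : omega n -> R) : R :=
  \sum_(w : omega n) toy_mass eta p p' w * f w.

Definition toy_cond n eta (p p' : 'I_n -> R) (A B : pred (omega n)) : R :=
  toy_prob eta p p' (predI A B) / toy_prob eta p p' B.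

Definition lin_pred n (b0 : R) (b : 'I_n -> R) (x : {ffun 'I_n -> bool}) : R :=
  b0 + \sum_(i < n) b i * sgnb (x i).

Definition risk n eta (p p' : 'I_n -> R) (b0 : R) (b : 'I_n -> R) : R :=
  toy_expect eta p p' (fun w => (lin_pred b0 b w.1.1 - sgnb w.1.2) ^+ 2).

Definition is_risk_minimizer n eta (p p' : 'I_n -> R) (b0 : R) (b : 'I_n -> R) : Prop :=
  forall (c0 : R) (c : 'I_n -> R), risk eta p p' b0 b <= risk eta p p' c0 c.

Definition bin_entropy (q : R) : R := - (q * ln q) - (1 - q) * ln (1 - q).

Definition entropy_fun n (b0 : R) (b : 'I_n -> R) (x : {ffun 'I_n -> bool}) : R :=
  let s := lin_pred b0 b x in bin_entropy (expR s / (1 + expR s)).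

Definition cdf_toy n eta (p p' : 'I_n -> R) (V : omega n -> R) (v : R) : R :=
  toy_prob eta p p' (fun w => V w <= v).

Definition cdf_bern n (q : 'I_n -> R) (V : {ffun 'I_n -> bool} -> R) (v : R) : R :=
  \sum_(x : {ffun 'I_n -> bool} | V x <= v) bern q x.

Definition Psi n (Lam : R -> R -> R) (p p' : 'I_n -> R) (x : {ffun 'I_n -> bool}) : R :=
  \sum_(i < n) Lam (p i) (p' i) * sgnb (x i).

Definition R_score n (Lam : R -> R -> R) (p p' : 'I_n -> R)
    (x : {ffun 'I_n -> bool}) (z : bool) : R :=
  if z then cdf_bern p (Psi Lam p p') (Psi Lam p p' x)
  else cdf_bern p' (Psi Lam p' p) (Psi Lam p' p x).

Definition A_plus : set (R * R) :=
  [set qq | 0 <= qq.1 <= 1 /\ 0 <= qq.2 <= 1 /\ qq.2 < qq.1].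
Definition A_minus : set (R * R) :=
  [set qq | 0 <= qq.1 <= 1 /\ 0 <= qq.2 <= 1 /\ qq.1 < qq.2].

Definition sign_respecting (Lam : R -> R -> R) : Prop :=
  [/\ {within A_plus, continuous (fun qq : R * R => Lam qq.1 qq.2)},
      {within A_minus, continuous (fun qq : R * R => Lam qq.1 qq.2)},
      (forall qq, A_plus qq -> 0 < Lam qq.1 qq.2) &
      (forall qq, A_minus qq -> Lam qq.1 qq.2 < 0)].

End Toy.

(* Main.v *)
(* The normal equations give L = t (S/2 + U) under B_p and -t (S/2 + U') under
   B_p', where L is the affine predictor, t > 0, S is of order n, and U, U' are
   centered weighted sums of the coordinates.  The entropy decreases in |L|, so
   the top delta-fraction is essentially a deep lower tail {U <= -tau sqrt n}
   (resp. {U' <= -tau sqrt n}) with the same tau for both classes.  A large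
   spurious score R forces the centered score V to be at least -C' sqrt n.  Since
   U and V are positively correlated, this is exponentially unlikely in the tail:
   let Q be the exponential tilt of the product measure, itself a product
   measure, under which U has mean -(tau + K) sqrt n.  Comparing both
   P[U <= -tau sqrt n, V >= -C' sqrt n] and P[U ~ -tau sqrt n] with their
   Q-probabilities, the moment generating functions cancel, the change of measure
   costs exp(O(tau)), and Hoeffding's bound under Q gains exp(-c tau^2).  No
   central limit theorem is needed. *)
Require Import Defs.
From HB Require Import structures.
From mathcomp Require Import all_boot all_order all_algebra.
From mathcomp Require Import all_classical all_reals all_analysis.
From mathcomp Require Import ring lra.
Import Order.TTheory GRing.Theory Num.Theory.
Import numFieldNormedType.Exports.
Local Open Scope ring_scope.

(** * Product Bernoulli measures *)

Section ProductBernoulli.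
Variables (R : realType) (n : nat).
Implicit Types (q w : 'I_n -> R) (x : {ffun 'I_n -> bool}) (A B : pred {ffun 'I_n -> bool}) (f g : {ffun 'I_n -> bool} -> R).

Definition prob q (A : pred {ffun 'I_n -> bool}) : R := \sum_(x | A x) bern q x.
Definition expect q (f : {ffun 'I_n -> bool} -> R) : R := \sum_x bern q x * f x.
Definition is_prob q := forall i, 0 <= q i <= 1.
(** The mean of a sign under [bern q] is [2 * q i - 1]. The centering is kept separate from the
    measure, so that a sum centered at [q] can also be studied under a tilted measure. *)
Definition cen q x i : R := sgnb R (x i) - (2 * q i - 1).
Definition clin w q x : R := \sum_i w i * cen q x i.

Lemma bern_ge0 q x : is_prob q -> 0 <= bern q x.
Proof.
move=> hq; apply: prodr_ge0 => i _; have /andP[h0 h1] := hq i.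
by case: (x i) => //; rewrite subr_ge0.
Qed.

(** Independence of the coordinates: by distributivity, a product of two-term sums expands into a
    sum over all sign vectors. *)
Lemma expect_prod q (g : 'I_n -> bool -> R) :
  expect q (fun x => \prod_i g i (x i)) =
  \prod_i (q i * g i true + (1 - q i) * g i false).
Proof.
have -> : \prod_i (q i * g i true + (1 - q i) * g i false) =
    \prod_i \sum_(b : bool) (if b then q i else 1 - q i) * g i b.
  by apply: eq_bigr => i _; rewrite big_bool.
rewrite (bigA_distr_bigA (fun i (b : bool) => (if b then q i else 1 - q i) * g i b)).
by apply: eq_bigr => x _; rewrite /bern -big_split.
Qed.

Lemma expectD q f g : expect q (fun x => f x + g x) = expect q f + expect q g.
Proof. by rewrite /expect -big_split; apply: eq_bigr => x _; rewrite mulrDr. Qed.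

Lemma expectZ q c f : expect q (fun x => c * f x) = c * expect q f.
Proof. by rewrite /expect mulr_sumr; apply: eq_bigr => x _; rewrite mulrCA. Qed.

Lemma expect_sum q (I : finType) (f : I -> {ffun 'I_n -> bool} -> R) :
  expect q (fun x => \sum_i f i x) = \sum_i expect q (f i).
Proof.
rewrite /expect exchange_big; apply: eq_bigr => x _; by rewrite mulr_sumr.
Qed.

Lemma expect_cst q c : expect q (fun=> c) = c.
Proof.
have := expect_prod q (fun _ _ => 1).
rewrite [RHS]big1 => [h|i _]; last by ring.
rewrite -[RHS]mulr1 -h /expect mulr_sumr; apply: eq_bigr => x _.
by rewrite big1 // mulr1 mulrC.
Qed.

Lemma eq_expect q f g : f =1 g -> expect q f = expect q g.
Proof. by move=> fg; apply: eq_bigr => x _; rewrite fg. Qed.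

Lemma ler_expect q f g : is_prob q -> (forall x, f x <= g x) ->
  expect q f <= expect q g.
Proof. by move=> hq fg; apply: ler_sum => x _; apply: ler_wpM2l => //; apply: bern_ge0. Qed.

Lemma probE q A : prob q A = expect q (fun x => (A x)%:R).
Proof.
rewrite /prob /expect big_mkcond; apply: eq_bigr => x _.
by case: (A x); rewrite ?mulr1 ?mulr0.
Qed.

Lemma prob_ge0 q A : is_prob q -> 0 <= prob q A.
Proof. by move=> hq; apply: sumr_ge0 => x _; apply: bern_ge0. Qed.

Lemma prob_sub q A B : is_prob q -> (forall x, A x -> B x) -> prob q A <= prob q B.
Proof.
move=> hq AB; rewrite !probE; apply: ler_expect => // x.
by rewrite ler_nat; have := AB x; case: (A x) (B x) => [] [] // /(_ isT).
Qed.

Lemma probC q A : prob q (fun x => ~~ A x) = 1 - prob q A.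
Proof.
have <- : expect q (fun x => (~~ A x)%:R + (A x)%:R) = 1.
  by rewrite -[RHS](expect_cst q); apply: eq_expect => x; case: (A x); rewrite /= ?addr0 ?add0r.
by rewrite expectD !probE addrK.
Qed.

Lemma markov_expect q A f : is_prob q -> (forall x, 0 <= f x) ->
  (forall x, A x -> 1 <= f x) -> prob q A <= expect q f.
Proof.
move=> hq f0 fA; rewrite probE; apply: ler_expect => // x.
by have := fA x; case: (A x) => // /(_ isT).
Qed.

Lemma expect_coord q i (f : bool -> R) :
  expect q (fun x => f (x i)) = q i * f true + (1 - q i) * f false.
Proof.
have -> : q i * f true + (1 - q i) * f false =
    \prod_j (if j == i then q j * f true + (1 - q j) * f false else 1).
  by rewrite -big_mkcond big_pred1_eq.
transitivity (expect q (fun x => \prod_j (if j == i then f (x j) else 1))).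
  by apply: eq_expect => x; rewrite -big_mkcond big_pred1_eq.
rewrite (expect_prod q (fun j b => if j == i then f b else 1)).
by apply: eq_bigr => j _; case: eqP => // _; ring.
Qed.

Lemma expect_coord2 q i j (f g : bool -> R) : i != j ->
  expect q (fun x => f (x i) * g (x j)) =
  (q i * f true + (1 - q i) * f false) * (q j * g true + (1 - q j) * g false).
Proof.
move=> ij.
rewrite -!expect_coord.
have E k (h : bool -> R) x : h (x k) = \prod_l (if l == k then h (x l) else 1).
  by rewrite -big_mkcond big_pred1_eq.
transitivity (expect q (fun x => \prod_l
  ((if l == i then f (x l) else 1) * (if l == j then g (x l) else 1)))).
  by apply: eq_expect => x; rewrite big_split /= -!E.
rewrite (expect_prod q (fun l b => (if l == i then f b else 1) * (if l == j then g b else 1))).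
rewrite (eq_expect q _ _ (E i f)) (eq_expect q _ _ (E j g)).
rewrite (expect_prod q (fun l b => if l == i then f b else 1)).
rewrite (expect_prod q (fun l b => if l == j then g b else 1)) -big_split /=.
apply: eq_bigr => l _; case: (altP (l =P i)) => [->|_]; last by case: eqP => _; ring.
by rewrite (negbTE ij); ring.
Qed.

Lemma expect_cen q i : expect q (fun x => cen q x i) = 0.
Proof.
rewrite (expect_coord q i (fun b => sgnb R b - (2 * q i - 1))) /sgnb; ring.
Qed.

Lemma expect_cen2 q i j :
  expect q (fun x => cen q x i * cen q x j) = (i == j)%:R * (4 * q i * (1 - q i)).
Proof.
case: (altP (i =P j)) => [<-|ij].
  rewrite (expect_coord q i (fun b => (sgnb R b - (2 * q i - 1)) * (sgnb R b - (2 * q i - 1)))).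
  by rewrite /sgnb mul1r; ring.
rewrite (expect_coord2 q i j (fun b => sgnb R b - (2 * q i - 1)) (fun b => sgnb R b - (2 * q j - 1)) ij).
by rewrite /sgnb mul0r; ring.
Qed.

Lemma expect_clin w q : expect q (clin w q) = 0.
Proof.
rewrite /clin expect_sum big1 // => i _; by rewrite expectZ expect_cen mulr0.
Qed.

Lemma expect_clin_cen w q j :
  expect q (fun x => clin w q x * cen q x j) = w j * (4 * q j * (1 - q j)).
Proof.
rewrite (eq_expect q _ (fun x => \sum_i w i * (cen q x i * cen q x j))); last first.
  by move=> x; rewrite /clin mulr_suml; apply: eq_bigr => i _; rewrite mulrA.
rewrite expect_sum (bigD1 j) //= expectZ expect_cen2 eqxx mul1r big1 ?addr0 // => i ij.
by rewrite expectZ expect_cen2 (negbTE ij) mul0r mulr0.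
Qed.

Lemma expect_clin_sq w q :
  expect q (fun x => clin w q x ^+ 2) = \sum_i w i ^+ 2 * (4 * q i * (1 - q i)).
Proof.
rewrite (eq_expect q _ (fun x => \sum_i w i * (clin w q x * cen q x i))); last first.
  by move=> x; rewrite expr2 {2}/clin mulr_sumr; apply: eq_bigr => i _; rewrite mulrCA.
rewrite expect_sum; apply: eq_bigr => i _.
by rewrite expectZ expect_clin_cen mulrA expr2.
Qed.

Lemma variance_le w q C : is_prob q -> (forall i, `|w i| <= C) ->
  expect q (fun x => clin w q x ^+ 2) <= C ^+ 2 * n%:R.
Proof.
move=> hq hw; rewrite expect_clin_sq.
have -> : C ^+ 2 * n%:R = \sum_(i < n) C ^+ 2.
  by rewrite sumr_const card_ord mulr_natr.
apply: ler_sum => i _; have /andP[h0 h1] := hq i.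
have h2 : w i ^+ 2 <= C ^+ 2 by rewrite -[leLHS]real_normK ?num_real // lerXn2r ?nnegrE // (le_trans _ (hw i)).
have h3 : 0 <= w i ^+ 2 by apply: sqr_ge0.
have h4 : 4 * q i * (1 - q i) <= 1 by have := sqr_ge0 (2 * q i - 1); lra.
have h5 : 0 <= 4 * q i * (1 - q i) by nra.
nra.
Qed.

Lemma chebyshev_clin w q C k : is_prob q -> (forall i, `|w i| <= C) -> 0 < k ->
  prob q (fun x => k <= `|clin w q x|) <= C ^+ 2 * n%:R / k ^+ 2.
Proof.
move=> hq hw k0.
apply: (@le_trans _ _ (expect q (fun x => k ^- 2 * clin w q x ^+ 2))).
  apply: markov_expect => // x.
    by rewrite mulr_ge0 ?sqr_ge0 // invr_ge0 sqr_ge0.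
  move=> hk; rewrite mulrC ler_pdivlMr ?exprn_gt0 // mul1r.
  by rewrite -[leRHS]real_normK ?num_real // lerXn2r ?nnegrE // ltW.
rewrite expectZ mulrC ler_pM2r ?invr_gt0 ?exprn_gt0 //.
exact: variance_le.
Qed.

End ProductBernoulli.

(** * Exponential tilting *)

Section Exponentials.
Variable R : realType.
Implicit Types q w y z e : R.

(** From [expR (- y) >= 1 - y] one gets [expR y <= 1 / (1 - y)], and [(1 + y + 2 y^2)(1 - y) - 1 =
    y^2 (1 - 2 y) >= 0]. *)
Lemma expR_le_quadratic y : y <= 1 / 2 -> expR y <= 1 + y + 2 * y ^+ 2.
Proof.
move=> hy; have h := expR_ge1Dx (- y).
have h1 : expR y * expR (- y) = 1 by rewrite expRxMexpNx_1.
have h2 : 0 < expR y := expR_gt0 y.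
have h3 : expR y * (1 - y) <= 1 by rewrite -[leRHS]h1 ler_pM2l.
have h4 : 0 < 1 - y by lra.
rewrite -(ler_pM2r h4); apply: (le_trans h3).
have : 0 <= y ^+ 2 * (1 - 2 * y) by rewrite mulr_ge0 ?sqr_ge0; lra.
by lra.
Qed.

(** The linear term averages to zero over a centered variable, which leaves a sub-Gaussian bound.
    For [y > 1 / 2] it follows from [y <= 2 y^2]. *)
Lemma expR_le_id_expR_sq y : expR y <= y + expR (2 * y ^+ 2).
Proof.
have [hy|hy] := leP y (1 / 2).
  apply: (le_trans (expR_le_quadratic _ hy)).
  have := expR_ge1Dx (2 * y ^+ 2); lra.
have h : expR y <= expR (2 * y ^+ 2) by rewrite ler_expR; nra.
lra.
Qed.

(** A crude Hoeffding lemma: the linear terms cancel by centering, and both deviations are at most 2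
    in absolute value, whence [2 (2 z)^2 = 8 z^2]. *)
Lemma hoeffding1 q z : 0 <= q <= 1 ->
  q * expR (z * (1 - (2 * q - 1))) + (1 - q) * expR (z * (-1 - (2 * q - 1)))
  <= expR (8 * z ^+ 2).
Proof.
move=> /andP[q0 q1].
have h1 := expR_le_id_expR_sq (z * (1 - (2 * q - 1))).
have h2 := expR_le_id_expR_sq (z * (-1 - (2 * q - 1))).
have h3 : expR (2 * (z * (1 - (2 * q - 1))) ^+ 2) <= expR (8 * z ^+ 2).
  rewrite ler_expR; have z2 := sqr_ge0 z.
  have : (1 - q) ^+ 2 <= 1 by nra.
  have -> : 2 * (z * (1 - (2 * q - 1))) ^+ 2 = 8 * (z ^+ 2 * (1 - q) ^+ 2) by ring.
  nra.
have h4 : expR (2 * (z * (-1 - (2 * q - 1))) ^+ 2) <= expR (8 * z ^+ 2).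
  rewrite ler_expR; have z2 := sqr_ge0 z.
  have : q ^+ 2 <= 1 by nra.
  have -> : 2 * (z * (-1 - (2 * q - 1))) ^+ 2 = 8 * (z ^+ 2 * q ^+ 2) by ring.
  nra.
have h5 := le_trans h1 (lerD (lexx _) h3).
have h6 := le_trans h2 (lerD (lexx _) h4).
have h7 := ler_wpM2l q0 h5.
have h8 : 0 <= 1 - q by lra.
have h9 := ler_wpM2l h8 h6.
apply: (le_trans (lerD h7 h9)); lra.
Qed.

(* Success probability of a Bernoulli(q) sign after exponential tilting; the
   weight w is twice the tilting parameter because the two signs differ by 2. *)
Definition tilt1 q w : R := q / (q + (1 - q) * expR w).

Lemma tilt1_den_gt0 q w : 0 <= q <= 1 -> 0 < q + (1 - q) * expR w.
Proof.
move=> /andP[q0 q1]; have e0 := expR_gt0 w.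
have [->|qn] := eqVneq q 0; first by rewrite subr0 mul1r add0r.
have : 0 < q by rewrite lt_neqAle eq_sym qn.
have : 0 <= (1 - q) * expR w by rewrite mulr_ge0; lra.
lra.
Qed.

Lemma tilt1_prob q w : 0 <= q <= 1 -> 0 <= tilt1 q w <= 1.
Proof.
move=> hq; have d0 := tilt1_den_gt0 q w hq; have /andP[q0 q1] := hq.
rewrite /tilt1 divr_ge0 ?(ltW d0) //= ler_pdivrMr // mul1r lerDl mulr_ge0 ?expR_ge0 //.
by rewrite subr_ge0.
Qed.

Lemma tilt1_onem q w : 0 <= q <= 1 ->
  1 - tilt1 q w = (1 - q) * expR w / (q + (1 - q) * expR w).
Proof.
move=> hq; have d0 := tilt1_den_gt0 q w hq.
by rewrite /tilt1; field; rewrite gt_eqF.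
Qed.

Lemma tilt1_shift q w : 0 <= q <= 1 ->
  q - tilt1 q w = q * (1 - q) * (expR w - 1) / (q + (1 - q) * expR w).
Proof.
move=> hq; have d0 := tilt1_den_gt0 q w hq.
by rewrite /tilt1; field; rewrite gt_eqF.
Qed.

(** The shift is [q (1 - q) (expR w - 1) / D] with [D] between 3/4 and 2. The constant [e / 8]
    collects [q (1 - q) >= e / 2], [w (expR w - 1) >= w^2 / 2] and [D <= 2]. *)
Lemma tilt1_shift_bounds q w e : 0 < e < 1 / 2 -> e <= q <= 1 - e -> `|w| <= 1 / 4 ->
  e / 8 * w ^+ 2 <= w * (q - tilt1 q w) /\ `|q - tilt1 q w| <= `|w|.
Proof.
move=> /andP[e0 e1] /andP[q0 q1]; rewrite ler_norml => /andP[w0 w1].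
have hq : 0 <= q <= 1 by apply/andP; split; lra.
have d0 := tilt1_den_gt0 q w hq.
have E1 := expR_ge1Dx w.
have E2 : expR w <= 1 + w + 2 * w ^+ 2 by apply: expR_le_quadratic; lra.
have w2 : w ^+ 2 <= 1 / 16 by nra.
have w20 := sqr_ge0 w.
have d1 : q + (1 - q) * expR w <= 2.
  have : expR w <= 2 by lra.
  nra.
have d2 : 3 / 4 <= q + (1 - q) * expR w.
  have : 3 / 4 <= expR w by lra.
  nra.
rewrite tilt1_shift //.
set D := q + (1 - q) * expR w in d0 d1 d2 *.
have qq : e / 2 <= q * (1 - q) by nra.
have qq' : q * (1 - q) <= 1 / 4 by have := sqr_ge0 (2 * q - 1); lra.
split.
  rewrite mulrA ler_pdivlMr //.
  have h : w ^+ 2 / 2 <= w * (expR w - 1).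
    have [w3|w3] := leP 0 w; first by nra.
    have : expR w - 1 <= w * (1 + 2 * w) by lra.
    move=> /(ler_wnM2l (ltW w3)); nra.
  have h' : e / 2 * (w ^+ 2 / 2) <= q * (1 - q) * (w * (expR w - 1)).
    by apply: ler_pM => //; lra.
  have h'' : e / 8 * w ^+ 2 * D <= e / 8 * w ^+ 2 * 2.
    by apply: ler_wpM2l => //; apply: mulr_ge0 => //; lra.
  by lra.
have aw : `|expR w - 1| <= 3 / 2 * `|w|.
  have [w3|w3] := leP 0 w.
    by rewrite !ger0_norm //; nra.
  by rewrite (ltr0_norm w3) ler_norml; apply/andP; split; nra.
rewrite normrM normfV normrM (ger0_norm (ltW d0)) (@ger0_norm _ (q * (1 - q))); last lra.
rewrite ler_pdivrMr //.
have an := normr_ge0 w.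
have h1 : q * (1 - q) * `|expR w - 1| <= 1 / 4 * (3 / 2 * `|w|).
  by apply: ler_pM => //; lra.
have h2 : `|w| * (3 / 4) <= `|w| * D by apply: ler_wpM2l.
by lra.
Qed.

Lemma tilt1_continuous q u : 0 <= q <= 1 ->
  continuous (fun t : R => tilt1 q (2 * t * u)).
Proof.
move=> hq t; rewrite /tilt1.
apply: cvgM; first exact: cvg_cst.
apply: cvgV; first by rewrite gt_eqF // tilt1_den_gt0.
apply: cvgD; first exact: cvg_cst.
apply: cvgM; first exact: cvg_cst.
apply: (@continuous_comp _ _ _ (fun t : R => 2 * t * u) expR); last exact: continuous_expR.
apply: cvgM; last exact: cvg_cst.
apply: cvgM; [exact: cvg_cst|exact: cvg_id].
Qed.

End Exponentials.

(** * Tilted product measures and Chernoff bounds *)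

Section Tilting.
Variables (R : realType) (n : nat).
Implicit Types (q u w : 'I_n -> R) (x : {ffun 'I_n -> bool}).

(** The tilted measure has density proportional to [expR (- (t * clin u))], so that a positive [t]
    lowers the mean of [clin u]. *)
Definition tilt q u (t : R) : 'I_n -> R := fun i => tilt1 R (q i) (2 * t * u i).
Definition mean_shift w q q' : R := \sum_i w i * (2 * (q' i - q i)).
Definition mgf q u (t : R) : R := expect R n q (fun x => expR (- (t * clin R n u q x))).

Lemma tilt_prob q u t : is_prob R n q -> is_prob R n (tilt q u t).
Proof. by move=> hq i; apply: tilt1_prob. Qed.

Lemma clin_shift w q q' x : clin R n w q x = clin R n w q' x + mean_shift w q q'.
Proof.
rewrite /clin /mean_shift -big_split; apply: eq_bigr => i _ /=.
by rewrite /cen; ring.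
Qed.

(** The identity holds coordinate by coordinate, with [m i] the moment generating factor of one
    coordinate. Summing over all [x] identifies the product of the [m i] with [mgf], since the
    tilted masses sum to 1. *)
Lemma bern_tilt q u t x : is_prob R n q ->
  bern q x * expR (- (t * clin R n u q x)) = mgf q u t * bern (tilt q u t) x.
Proof.
move=> hq.
pose m i := expR (- (2 * t * u i) * (1 - q i)) * (q i + (1 - q i) * expR (2 * t * u i)).
have E y : bern q y * expR (- (t * clin R n u q y)) = (\prod_i m i) * bern (tilt q u t) y.
  rewrite /clin mulr_sumr -sumrN expR_sum /bern -!big_split /=; apply: eq_bigr => i _.
  have d0 := tilt1_den_gt0 R _ (2 * t * u i) (hq i).
  rewrite /cen /sgnb /tilt /m; case: (y i).
    have -> : - (t * (u i * (1 - (2 * q i - 1)))) = - (2 * t * u i) * (1 - q i) by ring.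
    by rewrite /tilt1; field; rewrite gt_eqF.
  rewrite tilt1_onem //.
  have -> : - (t * (u i * (-1 - (2 * q i - 1)))) =
    - (2 * t * u i) * (1 - q i) + 2 * t * u i by ring.
  by rewrite expRD; field; rewrite gt_eqF.
suff -> : mgf q u t = \prod_i m i by apply: E.
rewrite /mgf /expect (eq_bigr _ (fun y _ => E y)) -mulr_sumr.
have -> : \sum_y bern (tilt q u t) y = 1.
  rewrite -[RHS](expect_cst R n (tilt q u t)); apply: eq_bigr => y _.
  by rewrite mulr1.
by rewrite mulr1.
Qed.

(** Jensen's inequality for a centered sum, by [expR y >= 1 + y]. It also allows [mgf] to be dropped
    from lower bounds on a probability. *)
Lemma mgf_ge1 q u t : is_prob R n q -> 1 <= mgf q u t.
Proof.
move=> hq; have <- : expect R n q (fun x => 1 + (- t) * clin R n u q x) = 1.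
  by rewrite expectD expectZ expect_cst expect_clin mulr0 addr0.
apply: ler_expect => // x; rewrite mulNr; exact: expR_ge1Dx.
Qed.

(* [prob_tilt_le] and [prob_tilt_ge] carry the same factor [mgf], which cancels when
   two tail probabilities are compared. *)
Lemma prob_tilt_le q u t l (A B : pred {ffun 'I_n -> bool}) : is_prob R n q -> 0 <= t ->
  (forall x, A x -> clin R n u q x <= l) -> (forall x, A x -> B x) ->
  prob R n q A <= mgf q u t * expR (t * l) * prob R n (tilt q u t) B.
Proof.
move=> hq t0 hA AB.
have hM := le_trans ler01 (mgf_ge1 q u t hq).
have hl x : 0 <= mgf q u t * expR (t * l) * bern (tilt q u t) x.
  apply: mulr_ge0; first by rewrite mulr_ge0 ?expR_ge0.
  by apply: bern_ge0; apply: tilt_prob.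
rewrite /prob mulr_sumr [leLHS]big_mkcond [leRHS]big_mkcond.
apply: ler_sum => x _; have := AB x; have := hA x; case: (A x); last first.
  by case: (B x).
move=> /(_ isT) h /(_ isT) ->.
rewrite mulrAC -bern_tilt // -mulrA -expRD -[leLHS]mulr1 ler_wpM2l ?bern_ge0 //.
by rewrite -expR0 ler_expR addrC subr_ge0 ler_wpM2l.
Qed.

Lemma prob_tilt_ge q u t l (A : pred {ffun 'I_n -> bool}) : is_prob R n q -> 0 <= t ->
  (forall x, A x -> l <= clin R n u q x) ->
  mgf q u t * expR (t * l) * prob R n (tilt q u t) A <= prob R n q A.
Proof.
move=> hq t0 hA.
rewrite /prob mulr_sumr; apply: ler_sum => x /hA h.
rewrite mulrAC -bern_tilt // -mulrA -expRD -[leRHS]mulr1 ler_wpM2l ?bern_ge0 //.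
by rewrite -expR0 ler_expR addrC subr_le0 ler_wpM2l.
Qed.

Lemma hoeffding_mgf q w C s : is_prob R n q -> (forall i, `|w i| <= C) ->
  expect R n q (fun x => expR (s * clin R n w q x)) <= expR (8 * s ^+ 2 * C ^+ 2 * n%:R).
Proof.
move=> hq hw.
rewrite (eq_expect _ _ _ _
  (fun x => \prod_i expR (s * w i * (sgnb R (x i) - (2 * q i - 1))))); last first.
  move=> x; rewrite /clin mulr_sumr expR_sum; apply: eq_bigr => i _.
  by rewrite /cen mulrA.
rewrite (expect_prod R n q (fun i b => expR (s * w i * (sgnb R b - (2 * q i - 1))))).
have -> : 8 * s ^+ 2 * C ^+ 2 * n%:R = \sum_(i < n) 8 * s ^+ 2 * C ^+ 2.
  by rewrite sumr_const card_ord mulr_natr.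
rewrite expR_sum; apply: ler_prod => i _; have /andP[q0 q1] := hq i.
apply/andP; split.
  by rewrite addr_ge0 // mulr_ge0 ?expR_ge0 // subr_ge0.
apply: (le_trans (hoeffding1 R _ (s * w i) (hq i))).
rewrite ler_expR.
have h2 : w i ^+ 2 <= C ^+ 2.
  by rewrite -[leLHS]real_normK ?num_real // lerXn2r ?nnegrE // (le_trans _ (hw i)).
have := sqr_ge0 s; rewrite exprMn => hs.
by rewrite -mulrA ler_wpM2l // ler_wpM2l.
Qed.

Lemma chernoff q w C s k : is_prob R n q -> (forall i, `|w i| <= C) -> 0 <= s ->
  prob R n q (fun x => k <= clin R n w q x) <=
  expR (8 * s ^+ 2 * C ^+ 2 * n%:R - s * k).
Proof.
move=> hq hw s0.
apply: (@le_trans _ _ (expect R n q (fun x => expR (- (s * k)) * expR (s * clin R n w q x)))).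
  apply: markov_expect => // x hx.
  by rewrite -expRD -[leLHS]expR0 ler_expR addrC subr_ge0 ler_wpM2l.
rewrite expectZ addrC expRD ler_pM2l ?expR_gt0 //.
exact: hoeffding_mgf.
Qed.

End Tilting.

(** * Comparison of tails *)

Section TailComparison.
Variable R : realType.

(** Up to a scalar, [u] will be the weights of the linear predictor, and [v] those of the spurious
    cue score. The bound [c <= u i * v i] is the positive correlation: a tilt that lowers [clin u]
    also lowers [clin v]. *)
Definition tail_hyp n (e c C : R) (q u v : 'I_n -> R) :=
  forall i, [/\ e <= q i <= 1 - e, `|u i| <= C, `|v i| <= C,
                c <= u i ^+ 2 & c <= u i * v i].
(** The lower end controls the change-of-measure factor in [prob_tilt_ge]; the strict upper end
    later yields a strict inequality on the size of the predictor. *)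
Definition window n (q u : 'I_n -> R) (tau K : R) : pred {ffun 'I_n -> bool} :=
  fun x => (- ((tau + K) * Num.sqrt n%:R) < clin R n u q x) &&
           (clin R n u q x < - (tau * Num.sqrt n%:R)).
Definition joint_tail n (q u v : 'I_n -> R) (tau K : R) : pred {ffun 'I_n -> bool} :=
  fun x => (clin R n u q x <= - (tau * Num.sqrt n%:R)) &&
           (- (K * Num.sqrt n%:R) <= clin R n v q x).

Lemma sumr_ge_cst n (F : 'I_n -> R) a : (forall i, a <= F i) -> n%:R * a <= \sum_i F i.
Proof.
move=> h; have -> : n%:R * a = \sum_(i < n) a by rewrite sumr_const card_ord mulr_natl.
exact: ler_sum.
Qed.

Lemma sumr_le_cst n (F : 'I_n -> R) a : (forall i, F i <= a) -> \sum_i F i <= n%:R * a.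
Proof.
move=> h; have -> : n%:R * a = \sum_(i < n) a by rewrite sumr_const card_ord mulr_natl.
exact: ler_sum.
Qed.

(** The shift of coordinate [i] has the sign of [u i] and size of order [t]; since [u i * v i] is
    positive, it also has the sign of [v i]. *)
Lemma tilt_coord_bounds n (e c C t : R) (q u v : 'I_n -> R) i : 0 < e < 1 / 2 ->
  0 < c -> tail_hyp n e c C q u v -> 0 < t -> t * C <= 1 / 8 ->
  [/\ e * c / 4 * t <= u i * (q i - tilt R n q u t i),
      u i * (q i - tilt R n q u t i) <= 2 * C ^+ 2 * t &
      e * c / 4 * t <= v i * (q i - tilt R n q u t i)].
Proof.
move=> he c0 H t0 tC; have /andP[e0 e1] := he.
have [hq hu hv hc huv] := H i.
have hw : `|2 * t * u i| <= 1 / 4.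
  rewrite normrM ger0_norm; last by lra.
  have : t * `|u i| <= t * C by rewrite ler_wpM2l // ltW.
  lra.
have [h1 h2] := tilt1_shift_bounds R (q i) _ e he hq hw.
rewrite -/(tilt R n q u t i) in h1 h2.
set s := q i - _ in h1 h2 *.
have a : e / 4 * t * u i ^+ 2 <= u i * s.
  have t2 : 0 < 2 * t by lra.
  rewrite -(ler_pM2l t2); lra.
have u2 : 0 < u i ^+ 2 by lra.
split.
- apply: le_trans a.
  have -> : e * c / 4 * t = (e * t / 4) * c by field.
  have -> : e / 4 * t * u i ^+ 2 = (e * t / 4) * u i ^+ 2 by field.
  by rewrite ler_wpM2l // divr_ge0 // mulr_ge0 // ltW.
- apply: (le_trans (ler_norm _)); rewrite normrM.
  rewrite normrM [`|2 * t|]ger0_norm in h2; last lra.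
  have h3 : `|u i| * `|s| <= C * (2 * t * C).
    apply: ler_pM => //; apply: (le_trans h2); rewrite ler_wpM2l //; lra.
  by lra.
(* Multiplying by [u i ^+ 2] factors the quantity as [(u i * v i) * (u i * s)], both factors being
   bounded below, which avoids cases on signs. *)
- rewrite -(ler_pM2l u2).
  have -> : u i ^+ 2 * (v i * s) = (u i * v i) * (u i * s) by ring.
  have et : 0 <= e * t / 4 by rewrite divr_ge0 // mulr_ge0 //; lra.
  apply: (@le_trans _ _ (u i * v i * (e / 4 * t * u i ^+ 2))).
    have -> : u i ^+ 2 * (e * c / 4 * t) = (e * t / 4) * (c * u i ^+ 2) by field.
    have -> : u i * v i * (e / 4 * t * u i ^+ 2) = (e * t / 4) * (u i * v i * u i ^+ 2) by field.
    by rewrite ler_wpM2l // ler_wpM2r // ltW.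
  by rewrite ler_wpM2l //; lra.
Qed.

Lemma tilt_shift_bounds n (e c C t : R) (q u v : 'I_n -> R) : 0 < e < 1 / 2 ->
  0 < c -> tail_hyp n e c C q u v -> 0 < t -> t * C <= 1 / 8 ->
  [/\ mean_shift R n u q (tilt R n q u t) <= - (e * c / 2 * t * n%:R),
      - (4 * C ^+ 2 * t * n%:R) <= mean_shift R n u q (tilt R n q u t) &
      mean_shift R n v q (tilt R n q u t) <= - (e * c / 2 * t * n%:R)].
Proof.
move=> he c0 H t0 tC.
have B i := tilt_coord_bounds n e c C t q u v i he c0 H t0 tC.
have E (a : R) : - (a * n%:R) = n%:R * (- a) by ring.
rewrite !E; split.
- by apply: sumr_le_cst => i; have [] := B i; lra.
- by apply: sumr_ge_cst => i; have [] := B i; lra.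
- by apply: sumr_le_cst => i; have [] := B i; lra.
Qed.

Lemma tail_hyp_prob n (e c C : R) (q u v : 'I_n -> R) : 0 < e < 1 / 2 ->
  tail_hyp n e c C q u v -> is_prob R n q.
Proof. by move=> /andP[e0 e1] H i; have [/andP[q0 q1] _ _ _ _] := H i; apply/andP; split; lra. Qed.

Lemma shift_continuous n (q u : 'I_n -> R) : is_prob R n q ->
  continuous (fun t => mean_shift R n u q (tilt R n q u t)).
Proof.
move=> hq t; rewrite /mean_shift.
apply: cvg_big => [|i _]; first exact: add_continuous.
apply: cvgM; first exact: cvg_cst.
apply: cvgM; first exact: cvg_cst.
apply: cvgB; last exact: cvg_cst.
exact: tilt1_continuous.
Qed.

(** Intermediate value theorem between [t = 0], with no shift, and [t1 = 1 / (8 C)], the largest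
    tilt covered by [tilt_shift_bounds]. At [t1] the shift is at most [- e c n / (16 C)], whence the
    condition on [m]. *)
Lemma tilt_mean_exists n (e c C m : R) (q u v : 'I_n -> R) : 0 < e < 1 / 2 ->
  0 < c -> 0 < C -> tail_hyp n e c C q u v ->
  0 < m -> m <= e * c / (16 * C) * n%:R ->
  exists t, [/\ 0 < t, t * C <= 1 / 8 & mean_shift R n u q (tilt R n q u t) = - m].
Proof.
move=> he c0 C0 H m0 hm; have hq := tail_hyp_prob n e c C q u v he H.
pose t1 := (8 * C)^-1.
have t10 : 0 < t1 by rewrite invr_gt0; lra.
have t1C : t1 * C = 1 / 8 by rewrite /t1; field; rewrite gt_eqF.
have t1C' : t1 * C <= 1 / 8 by rewrite t1C.
have s0 : mean_shift R n u q (tilt R n q u 0) = 0.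
  rewrite /mean_shift big1 // => i _; rewrite /tilt /tilt1 mulr0 mul0r expR0.
  by rewrite mulr1 addrCA subrr addr0 divr1 subrr !mulr0.
have s1 : mean_shift R n u q (tilt R n q u t1) <= - m.
  have [h _ _] := tilt_shift_bounds n e c C t1 q u v he c0 H t10 t1C'.
  apply: (le_trans h); rewrite lerN2; apply: (le_trans hm).
  by rewrite le_eqVlt; apply/orP; left; apply/eqP; rewrite /t1; field; rewrite gt_eqF.
have [||t ht et] := @IVT R (fun t => mean_shift R n u q (tilt R n q u t)) 0 t1 (- m) (ltW t10).
- by apply: continuous_subspaceT; apply: shift_continuous.
- by rewrite s0 ge_min le_max s1 orbT oppr_le0 (ltW m0).
have /andP[t0 tt1] : 0 <= t <= t1 by move: ht; rewrite in_itv.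
exists t; split => //.
- rewrite lt_neqAle t0 andbT; apply/eqP => t00; move: et; rewrite -t00 s0; lra.
- by rewrite -t1C ler_wpM2r // ltW.
Qed.

(* [lam] is the tilting parameter times sqrt n.  The window is centered at the
   tilted mean with at least two standard deviations on each side, so it has tilted
   probability at least 1/2 by Chebyshev; the factor quadratic in [lam] comes from
   the Chernoff bound for [clin v], whose tilted mean is of order -lam sqrt n. *)
Lemma tilted_tail n (e c C C' tau : R) (q u v : 'I_n -> R) : 0 < e < 1 / 2 ->
  0 < c -> 0 < C -> tail_hyp n e c C q u v -> 0 <= tau ->
  (0 < n)%N -> (tau + 2 * C) * (16 * C / (e * c)) <= Num.sqrt n%:R ->
  exists lam, [/\ 0 < lam, tau + 2 * C <= 4 * C ^+ 2 * lam,
    e * c / 2 * lam <= tau + 2 * C,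
    expR (- (lam * (tau + 4 * C))) / 2 <= prob R n q (window n q u tau (4 * C)) &
    prob R n q (joint_tail n q u v tau C') <=
      2 * expR (lam * (4 * C + e * c / (32 * C ^+ 2) * (C' - e * c / 4 * lam))) *
      prob R n q (window n q u tau (4 * C))].
Proof.
move=> he c0 C0 H tau0 n0; have /andP[e0 e1] := he.
have hq := tail_hyp_prob n e c C q u v he H.
have ec0 : 0 < e * c by apply: mulr_gt0.
have nE : (n%:R : R) = Num.sqrt n%:R ^+ 2 by rewrite sqr_sqrtr ?ler0n.
have r0 : 0 < Num.sqrt n%:R :> R by rewrite sqrtr_gt0 ltr0n.
rewrite /window /joint_tail; move: nE r0; set r : R := Num.sqrt n%:R => nE r0 hr.
have m0 : 0 < (tau + 2 * C) * r by apply: mulr_gt0 => //; lra.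
have hm : (tau + 2 * C) * r <= e * c / (16 * C) * n%:R.
  rewrite nE expr2 mulrA ler_pM2r //.
  have -> : tau + 2 * C = e * c / (16 * C) * ((tau + 2 * C) * (16 * C / (e * c))).
    by field; rewrite !gt_eqF.
  by rewrite ler_pM2l //; apply: divr_gt0 => //; lra.
have [t [t0 tC et]] := tilt_mean_exists n e c C _ q u v he c0 C0 H m0 hm.
have [b1 b2 b3] := tilt_shift_bounds n e c C t q u v he c0 H t0 tC.
have hQ := tilt_prob R n q u t hq.
have M0 : 0 < mgf R n q u t by apply: lt_le_trans (mgf_ge1 R n q u t hq).
exists (t * r).
have l0 : 0 < t * r by apply: mulr_gt0.
set win := fun x : {ffun 'I_n -> bool} => _ && _.
have Qwin : 1 / 2 <= prob R n (tilt R n q u t) win.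
  have h := @chebyshev_clin R n u (tilt R n q u t) C (2 * C * r) hQ.
  have {}h : prob R n (tilt R n q u t)
      (fun x => 2 * C * r <= `|clin R n u (tilt R n q u t) x|) <= 1 / 4.
    apply: (le_trans (h _ _)).
    - by move=> i; have [] := H i.
    - by rewrite mulr_gt0 //; lra.
    by rewrite le_eqVlt; apply/orP; left; apply/eqP; rewrite nE; field; rewrite !gt_eqF.
  have h2 := probC R n (tilt R n q u t) (fun x => 2 * C * r <= `|clin R n u (tilt R n q u t) x|).
  have h3 : prob R n (tilt R n q u t)
      (fun x => ~~ (2 * C * r <= `|clin R n u (tilt R n q u t) x|)) <=
      prob R n (tilt R n q u t) win.
    apply: prob_sub => // x; rewrite -ltNge ltr_norml => /andP[x1 x2].
    rewrite /win (clin_shift R n u q (tilt R n q u t)) et; apply/andP; split; lra.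
  lra.
have Pwin : mgf R n q u t * expR (- (t * r * (tau + 4 * C))) / 2 <= prob R n q win.
  have h := @prob_tilt_ge R n q u t (- ((tau + 4 * C) * r)) win hq (ltW t0).
  apply: le_trans (h _); last by move=> x /andP[x1 _]; apply: ltW.
  have -> : t * - ((tau + 4 * C) * r) = - (t * r * (tau + 4 * C)) by ring.
  have P0 : 0 < mgf R n q u t * expR (- (t * r * (tau + 4 * C))).
    by rewrite mulr_gt0 ?expR_gt0.
  by rewrite ler_pM2l //; lra.
split => //.
- by rewrite -(ler_pM2r r0); move: b2; rewrite et nE; lra.
- by rewrite -(ler_pM2r r0); move: b1; rewrite et nE; lra.
- apply: le_trans Pwin; rewrite ler_pM2r ?invr_gt0 // ler_peMl ?expR_ge0 //.
  exact: mgf_ge1.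
(* Ratio of the Chernoff parameter to [t], chosen so that the quadratic cost
   [8 (g t)^2 C^2 n = g (e c / 4) t^2 n] is half of the gain [g (e c / 2) t^2 n] from the lowered
   mean of [clin v]. *)
pose g := e * c / (32 * C ^+ 2).
have g0 : 0 < g by rewrite divr_gt0 // mulr_gt0 // exprn_gt0.
have gC : 8 * g * C ^+ 2 = e * c / 4 by rewrite /g; field; rewrite !gt_eqF.
have QV : prob R n (tilt R n q u t) (fun x => - (C' * r) <= clin R n v q x) <=
    expR (t * r * (g * (C' - e * c / 4 * (t * r)))).
  pose k := - (C' * r) + e * c / 2 * t * n%:R.
  apply: (@le_trans _ _ (prob R n (tilt R n q u t)
     (fun x => k <= clin R n v (tilt R n q u t) x))).
    apply: prob_sub => // x; rewrite (clin_shift R n v q (tilt R n q u t)) /k => h; lra.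
  apply: (le_trans (@chernoff R n (tilt R n q u t) v C (g * t) k hQ _ _)).
  - by move=> i; have [] := H i.
  - by rewrite mulr_ge0 // ltW.
  rewrite ler_expR le_eqVlt; apply/orP; left; apply/eqP.
  have -> : 8 * (g * t) ^+ 2 * C ^+ 2 * n%:R = g * t ^+ 2 * (8 * g * C ^+ 2) * n%:R by ring.
  by rewrite gC /k nE; field.
(* The dependence on [tau] cancels against [Pwin]: only the width of the window survives, as
   [expR (lam * (4 * C))], and the factor 2 comes from [Qwin]. *)
apply: (le_trans (@prob_tilt_le R n q u t (- (tau * r)) _
  (fun x => - (C' * r) <= clin R n v q x) hq (ltW t0) _ _)).
- by move=> x /andP[].
- by move=> x /andP[].
have P1 : 0 <= mgf R n q u t * expR (t * - (tau * r)) by rewrite mulr_ge0 ?expR_ge0 // ltW.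
apply: (le_trans (ler_wpM2l P1 QV)).
have P2 : 0 <= 2 * expR (t * r * (4 * C + g * (C' - e * c / 4 * (t * r)))).
  by rewrite mulr_ge0 ?expR_ge0.
apply: le_trans (ler_wpM2l P2 Pwin).
rewrite le_eqVlt; apply/orP; left; apply/eqP.
have -> : 2 * expR (t * r * (4 * C + g * (C' - e * c / 4 * (t * r)))) *
   (mgf R n q u t * expR (- (t * r * (tau + 4 * C))) / 2) =
   mgf R n q u t * (expR (t * r * (4 * C + g * (C' - e * c / 4 * (t * r)))) *
    expR (- (t * r * (tau + 4 * C)))) by field.
rewrite -(mulrA (mgf R n q u t)) -!expRD; congr (_ * expR _); ring.
Qed.

(** The exponent in [tilted_tail] is a concave quadratic in [lam], so a deep enough tail brings the
    ratio below [k]. All constants are fixed before [n]; [k0] is a mass that the window at depth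
    [tau0] keeps for all large [n], and it will limit [delta]. *)
Lemma tail_domination (e c C C' k : R) : 0 < e < 1 / 2 ->
  0 < c -> 0 < C -> 0 <= C' -> 0 < k ->
  exists tau0 A k0 : R, [/\ 0 <= tau0, 0 < A, 0 < k0 &
  forall n (q u v : 'I_n -> R), (0 < n)%N -> tail_hyp n e c C q u v ->
   (A * (tau0 + 1) <= Num.sqrt n%:R -> k0 <= prob R n q (window n q u tau0 (4 * C))) /\
   forall tau, tau0 <= tau -> A * (tau + 1) <= Num.sqrt n%:R ->
     prob R n q (joint_tail n q u v tau C') <=
       k * prob R n q (window n q u tau (4 * C))].
Proof.
move=> he c0 C0 C'0 k_gt0; have /andP[e0 e1] := he.
have ec0 : 0 < e * c by apply: mulr_gt0.
pose g := e * c / (32 * C ^+ 2).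
have g0 : 0 < g by rewrite divr_gt0 // mulr_gt0 // exprn_gt0.
pose g2 := g * (e * c / 4).
have g20 : 0 < g2 by rewrite mulr_gt0 // divr_gt0.
(* Once [b <= g2 * lam] and [1 <= lam], the exponent is at most [- (2 / k)], and
   [expR (- (2 / k)) <= k / 2] absorbs the factor 2 of [tilted_tail]. *)
pose b := 4 * C + g * C' + 2 / k.
have k20 : 0 < 2 / k by apply: divr_gt0.
have b0 : 0 < b by have := mulr_ge0 (ltW g0) C'0; rewrite /b; lra.
pose lam0 := 1 + b / g2.
have l0 : 1 <= lam0 by rewrite lerDl divr_ge0 // ltW.
(* Since [tau + 2 * C <= 4 * C ^+ 2 * lam], a depth of at least [tau0] forces [lam0 <= lam]. *)
pose tau0 := 4 * C ^+ 2 * lam0.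
have C2 : 0 < C ^+ 2 by apply: exprn_gt0.
have t0 : 0 <= tau0 by rewrite mulr_ge0 //; lra.
pose A := (1 + 2 * C) * (16 * C / (e * c)).
have A0 : 0 < A by apply: mulr_gt0; [lra|apply: divr_gt0; lra].
(* Upper bound on [lam] at depth [tau0], independent of [n]. *)
pose L := (tau0 + 2 * C) / (e * c / 2).
pose k0 := expR (- (L * (tau0 + 4 * C))) / 2.
have hA n tau : 0 <= tau -> A * (tau + 1) <= Num.sqrt n%:R ->
    (tau + 2 * C) * (16 * C / (e * c)) <= Num.sqrt n%:R.
  move=> tau_ge0; apply: le_trans; rewrite /A.
  have -> : (1 + 2 * C) * (16 * C / (e * c)) * (tau + 1) =
    (1 + 2 * C) * (tau + 1) * (16 * C / (e * c)) by ring.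
  rewrite ler_wpM2r //; first by rewrite divr_ge0 //; lra.
  nra.
exists tau0, A, k0; split => //; first by rewrite divr_gt0 // expR_gt0.
move=> n q u v n0 H; split.
  move=> /(hA _ _ t0) hr.
  have [lam [lam_gt0 _ h2 h3 _]] := tilted_tail n e c C C' tau0 q u v he c0 C0 H t0 n0 hr.
  apply: le_trans h3; rewrite /k0 ler_pM2r ?invr_gt0 // ler_expR lerN2.
  apply: ler_wpM2r; first by lra.
  by rewrite /L ler_pdivlMr; [rewrite mulrC|lra].
move=> tau htau hr; have tau_ge0 := le_trans t0 htau.
have [lam [lam_gt0 h1 _ _ h4]] := tilted_tail n e c C C' tau q u v he c0 C0 H tau_ge0 n0 (hA _ _ tau_ge0 hr).
apply: (le_trans h4); apply: ler_wpM2r.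
  by apply: prob_ge0; exact: tail_hyp_prob H.
have hl : lam0 <= lam.
  rewrite -(@ler_pM2l _ (4 * C ^+ 2)); last lra.
  by apply: le_trans h1; rewrite -/tau0; lra.
have hl1 : 1 <= lam by lra.
have hb : b <= g2 * lam.
  have : b / g2 <= lam by rewrite /lam0 in hl; lra.
  by rewrite ler_pdivrMr // mulrC.
have hx : lam * (4 * C + g * (C' - e * c / 4 * lam)) <= - (2 / k).
  have h5 : 4 * C + g * (C' - e * c / 4 * lam) <= - (2 / k).
    by move: hb; rewrite /b /g2; lra.
  have h6 := ler_wpM2l (ltW lam_gt0) h5.
  have h7 : (2 / k) <= lam * (2 / k) by rewrite ler_peMl // ltW.
  lra.
have h8 : expR (lam * (4 * C + g * (C' - e * c / 4 * lam))) <= expR (- (2 / k)).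
  by rewrite ler_expR.
have h9 : expR (- (2 / k)) <= k / 2.
  rewrite expRN -[leRHS]invrK lef_pV2 ?posrE ?expR_gt0 ?invr_gt0 ?divr_gt0 //.
  rewrite invf_div; have := expR_ge1Dx (2 / k); lra.
rewrite /g in h8 *; lra.
Qed.

End TailComparison.

(** * Entropy and the risk minimizer *)

Section Entropy.
Variable R : realType.
Implicit Types q s t y : R.

Definition sigmoid s : R := expR s / (1 + expR s).

Lemma sigmoidN s : sigmoid (- s) = 1 - sigmoid s.
Proof.
have e0 := expR_gt0 s; rewrite /sigmoid expRN; field.
by rewrite !gt_eqF //; lra.
Qed.

Lemma bin_entropy_sigmoidN s : bin_entropy (sigmoid (- s)) = bin_entropy (sigmoid s).
Proof. by rewrite sigmoidN /bin_entropy opprB addrCA subrr addr0; ring. Qed.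

(** The right side is the value at 0 of the tangent at [s] to softplus, [ln (1 + expR s)], whose
    derivative is [sigmoid]. Monotonicity of the entropy thus reduces to convexity of softplus. *)
Lemma bin_entropy_sigmoid s :
  bin_entropy (sigmoid s) = ln (1 + expR s) - s * sigmoid s.
Proof.
have e0 := expR_gt0 s; have d0 : 0 < 1 + expR s by lra.
have h : 1 - sigmoid s = (1 + expR s)^-1 by rewrite /sigmoid; field; rewrite gt_eqF.
rewrite /bin_entropy h lnV ?posrE // {2}/sigmoid ln_div ?posrE // expRK -h.
by rewrite -/(sigmoid s); ring.
Qed.

Lemma sigmoid_itv s : 0 < sigmoid s < 1.
Proof.
have e0 := expR_gt0 s; have d0 : 0 < 1 + expR s by lra.
by rewrite /sigmoid divr_gt0 //= ltr_pdivrMr //; lra.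
Qed.

Lemma sigmoid_le s t : s <= t -> sigmoid s <= sigmoid t.
Proof.
move=> st; have es := expR_gt0 s; have et := expR_gt0 t.
have h : expR s <= expR t by rewrite ler_expR.
rewrite /sigmoid ler_pdivrMr; last lra.
rewrite mulrAC ler_pdivlMr; lra.
Qed.

(** Strict Jensen for the points 0 and [y]: after multiplication by [expR (- (q * y))], the bound
    [expR z >= 1 + z] applies at both centered points, strictly at one. *)
Lemma expR_lt_jensen q y : 0 < q < 1 -> y != 0 ->
  expR (q * y) < 1 - q + q * expR y.
Proof.
move=> /andP[q0 q1] y0.
have h1 : 1 + (1 - q) * y < expR ((1 - q) * y).
  by apply: expR_gt1Dx; rewrite mulf_neq0 // subr_eq0 eq_sym lt_eqF.
have h2 := expR_ge1Dx (- (q * y)).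
have h3 : 1 < (1 - q) * expR (- (q * y)) + q * expR ((1 - q) * y).
  have a : q * (1 + (1 - q) * y) < q * expR ((1 - q) * y) by rewrite ltr_pM2l.
  have b : (1 - q) * (1 + - (q * y)) <= (1 - q) * expR (- (q * y)).
    by rewrite ler_wpM2l //; lra.
  lra.
have e0 := expR_gt0 (q * y).
rewrite -(ltr_pM2l e0) mulr1 in h3.
apply: (lt_le_trans h3).
have E1 : expR (q * y) * expR (- (q * y)) = 1 by rewrite expRxMexpNx_1.
have E2 : expR (q * y) * expR ((1 - q) * y) = expR y.
  by rewrite -expRD; congr expR; ring.
have -> : expR (q * y) * ((1 - q) * expR (- (q * y)) + q * expR ((1 - q) * y)) =
  (1 - q) * (expR (q * y) * expR (- (q * y))) + q * (expR (q * y) * expR ((1 - q) * y)) by ring.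
by rewrite E1 E2 mulr1.
Qed.

(** Exponentiating and dividing by [1 + expR t] leaves [expR_lt_jensen] with weight [sigmoid t] at
    the point [s - t]. *)
Lemma softplus_tangent s t : s != t ->
  ln (1 + expR t) + sigmoid t * (s - t) < ln (1 + expR s).
Proof.
move=> st; have es := expR_gt0 s; have et := expR_gt0 t.
have dt : 0 < 1 + expR t by lra.
rewrite -ltr_expR expRD !lnK ?posrE; try lra.
have := expR_lt_jensen _ (s - t) (sigmoid_itv t).
rewrite subr_eq0 => /(_ st) h.
rewrite -(ltr_pM2l dt) in h; apply: (lt_le_trans h).
rewrite expRB /sigmoid le_eqVlt; apply/orP; left; apply/eqP; field.
by rewrite !gt_eqF.
Qed.

(** By evenness take [0 <= a < b]. The tangent at [b] lies below softplus at [a], and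
    [a * sigmoid a <= a * sigmoid b]. *)
Lemma bin_entropy_sigmoid_lt s t : `|s| < `|t| ->
  bin_entropy (sigmoid t) < bin_entropy (sigmoid s).
Proof.
have H (a b : R) : 0 <= a -> a < b -> bin_entropy (sigmoid b) < bin_entropy (sigmoid a).
  move=> a0 ab; rewrite !bin_entropy_sigmoid.
  have h1 : ln (1 + expR b) + sigmoid b * (a - b) < ln (1 + expR a).
    by apply: softplus_tangent; rewrite lt_eqF.
  have h2 := ler_wpM2l a0 (sigmoid_le _ _ (ltW ab)); lra.
have E (a : R) : bin_entropy (sigmoid `|a|) = bin_entropy (sigmoid a).
  have [a0|a0] := leP 0 a; first by rewrite ger0_norm.
  by rewrite ltr0_norm // bin_entropy_sigmoidN.
by move=> st; rewrite -E -[X in _ < X]E; apply: H.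
Qed.

End Entropy.

(** * Normal equations for the least-squares predictor *)

Section NormalEquations.
Variables (R : realType) (n : nat).
Implicit Types (q p b : 'I_n -> R) (x : {ffun 'I_n -> bool}).

(** The label weights [1 - eta] and [eta] sum to 1, so the noise disappears from events that ignore
    the label. *)
Lemma toy_prob_xz eta p p' (A : {ffun 'I_n -> bool} -> bool -> bool) :
  toy_prob eta p p' (fun w => A w.1.1 w.2) =
  (prob R n p (A^~ true) + prob R n p' (A^~ false)) / 2.
Proof.
rewrite /toy_prob /prob big_mkcond /=.
rewrite -(pair_bigA _ (fun xy z => if A xy.1 z then toy_mass eta p p' (xy, z) else 0)) /=.
rewrite -(pair_bigA _ (fun x y => \sum_z if A x z then toy_mass eta p p' ((x, y), z) else 0)) /=.
rewrite [in RHS]big_mkcond [X in _ + X]big_mkcond /= -big_split /= mulr_suml.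
apply: eq_bigr => x _; rewrite !big_bool /toy_mass /=.
by case: (A x true); case: (A x false); field.
Qed.

Lemma toy_expectE eta p p' (f : {ffun 'I_n -> bool} -> bool -> R) :
  toy_expect eta p p' (fun w => f w.1.1 w.1.2) =
  ((1 - eta) * expect R n p (f^~ true) + eta * expect R n p (f^~ false)
   + (1 - eta) * expect R n p' (f^~ false) + eta * expect R n p' (f^~ true)) / 2.
Proof.
rewrite /toy_expect /expect.
rewrite -(pair_bigA _ (fun xy z => toy_mass eta p p' (xy, z) * f xy.1 xy.2)) /=.
rewrite -(pair_bigA _ (fun x y => \sum_z toy_mass eta p p' ((x, y), z) * f x y)) /=.
rewrite !mulr_sumr -!big_split /= mulr_suml.
apply: eq_bigr => x _; rewrite !big_bool /toy_mass /=; by field.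
Qed.

Definition lbase (b0 : R) b q : R := b0 + \sum_i b i * (2 * q i - 1).

Lemma lin_predE (b0 : R) b q x : lin_pred b0 b x = lbase b0 b q + clin R n b q x.
Proof.
rewrite /lin_pred /lbase /clin -addrA -big_split; congr (_ + _).
by apply: eq_bigr => i _ /=; rewrite /cen; ring.
Qed.

(** A first-order condition without derivatives: for [a > 0] the vertex gives [- c^2 / (4 a) >= 0],
    and for [a <= 0] the values at 1 and -1 suffice. *)
Lemma quadratic_min_slope (a c : R) : (forall h : R, 0 <= c * h + a * h ^+ 2) -> c = 0.
Proof.
move=> H; have [a0|a0] := leP a 0.
  have := H 1; have := H (-1); lra.
have := H (- c / (2 * a)).
have -> : c * (- c / (2 * a)) + a * (- c / (2 * a)) ^+ 2 = - (c ^+ 2 / (4 * a)).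
  by field; rewrite gt_eqF.
rewrite oppr_ge0 pmulr_lle0 ?invr_gt0; last lra.
by move=> h; apply/eqP; rewrite -sqrf_eq0 eq_le h sqr_ge0.
Qed.

Lemma toy_expectD eta p p' (f g : omega n -> R) :
  toy_expect eta p p' (fun w => f w + g w) = toy_expect eta p p' f + toy_expect eta p p' g.
Proof. by rewrite /toy_expect -big_split; apply: eq_bigr => w _; rewrite mulrDr. Qed.

Lemma toy_expectZ eta p p' c (f : omega n -> R) :
  toy_expect eta p p' (fun w => c * f w) = c * toy_expect eta p p' f.
Proof. by rewrite /toy_expect mulr_sumr; apply: eq_bigr => w _; rewrite mulrCA. Qed.

(** Moving the minimizer by [h] along [lin_pred c0 c] changes the risk by a quadratic in [h] whose
    slope is twice this correlation. *)
Lemma risk_min_orthogonal eta p p' (b0 : R) b (c0 : R) (c : 'I_n -> R) : is_risk_minimizer eta p p' b0 b ->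
  toy_expect eta p p' (fun w => (lin_pred b0 b w.1.1 - sgnb R w.1.2) * lin_pred c0 c w.1.1) = 0.
Proof.
move=> hmin.
set E := toy_expect _ _ _ _.
suff : 2 * E = 0 by lra.
apply: (@quadratic_min_slope
  (toy_expect eta p p' (fun w => lin_pred c0 c w.1.1 ^+ 2))) => h.
have := hmin (b0 + h * c0) (fun i => b i + h * c i).
have L x : lin_pred (b0 + h * c0) (fun i => b i + h * c i) x = lin_pred b0 b x + h * lin_pred c0 c x.
  rewrite /lin_pred mulrDr mulr_sumr addrACA -big_split; congr (_ + _).
  by apply: eq_bigr => i _ /=; ring.
rewrite /risk.
have -> : toy_expect eta p p'
   (fun w => (lin_pred (b0 + h * c0) (fun i => b i + h * c i) w.1.1 - sgnb R w.1.2) ^+ 2) =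
   toy_expect eta p p' (fun w => (lin_pred b0 b w.1.1 - sgnb R w.1.2) ^+ 2 +
     (2 * h * ((lin_pred b0 b w.1.1 - sgnb R w.1.2) * lin_pred c0 c w.1.1) +
      h ^+ 2 * lin_pred c0 c w.1.1 ^+ 2)).
  by apply: eq_bigr => w _; rewrite L; congr (_ * _); ring.
rewrite !toy_expectD !toy_expectZ -/E; lra.
Qed.

Lemma expect_lin_pred_mul (b0 : R) b q (y k m : R) j :
  expect R n q (fun x => (lin_pred b0 b x - y) * (k + m * sgnb R (x j))) =
  (lbase b0 b q - y) * (k + m * (2 * q j - 1)) + m * (b j * (4 * q j * (1 - q j))).
Proof.
set A := lbase b0 b q.
rewrite (eq_expect _ _ _ _ (fun x => (A - y) * (k + m * (2 * q j - 1)) +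
   ((A - y) * m * cen R n q x j + ((k + m * (2 * q j - 1)) * clin R n b q x +
     m * (clin R n b q x * cen R n q x j))))); last first.
  by move=> x; rewrite (lin_predE b0 b q) -/A /cen; ring.
by rewrite !expectD !expectZ expect_cst expect_cen expect_clin expect_clin_cen; ring.
Qed.

(** A sign under [bern q] has variance [4 q (1 - q)], and [avg_var] averages it over the classes.
    [fisher] gives the weights of Fisher's linear discriminant, and [signal] is the gap between the
    class means of the resulting score. *)
Definition avg_var p p' : 'I_n -> R :=
  fun i => 2 * (p i * (1 - p i) + p' i * (1 - p' i)).
Definition fisher p p' : 'I_n -> R := fun i => 2 * (p i - p' i) / avg_var p p' i.
Definition signal p p' : R := \sum_i fisher p p' i * (2 * (p i - p' i)).

(* Testing the orthogonality relations against 1 and x_j gives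
   avg_var_j b_j = (const) 2 (p_j - p'_j): the rank-one part of the covariance only
   changes the scale t. *)
Lemma risk_min_lin_pred eta p p' (b0 : R) b : eta < 1 / 2 ->
  (forall i, 0 < avg_var p p' i) -> is_risk_minimizer eta p p' b0 b ->
  (0 < n)%N ->
  exists t : R, [/\ 0 < t,
    forall x, lin_pred b0 b x = t * (signal p p' / 2 + clin R n (fisher p p') p x) &
    forall x, lin_pred b0 b x = t * (- (signal p p' / 2) + clin R n (fisher p p') p' x)].
Proof.
move=> heta hD hmin n0.
set A := lbase b0 b p; set A' := lbase b0 b p'.
have E j k m : (lbase b0 b p + lbase b0 b p') * k
  + m * (A * (2 * p j - 1) + A' * (2 * p' j - 1) + 2 * avg_var p p' j * b j
         - (1 - 2 * eta) * 2 * (p j - p' j)) = 0.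
  have := risk_min_orthogonal eta p p' b0 b k (fun i => if i == j then m else 0) hmin.
  have L x : lin_pred k (fun i => if i == j then m else 0) x = k + m * sgnb R (x j).
    rewrite /lin_pred; congr (_ + _).
    rewrite -(big_pred1_eq +%R j (fun i => m * sgnb R (x i))) [RHS]big_mkcond.
    by apply: eq_bigr => i _; case: eqP => _ //; rewrite mul0r.
  have -> : toy_expect eta p p' (fun w => (lin_pred b0 b w.1.1 - sgnb R w.1.2)
      * lin_pred k (fun i => if i == j then m else 0) w.1.1) =
    toy_expect eta p p' (fun w => (lin_pred b0 b w.1.1 - sgnb R w.1.2)
      * (k + m * sgnb R (w.1.1 j))).
    by apply: eq_bigr => w _; rewrite L.
  rewrite (toy_expectE eta p p' (fun x y => (lin_pred b0 b x - sgnb R y) * (k + m * sgnb R (x j)))).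
  rewrite !expect_lin_pred_mul -/A -/A' /sgnb /avg_var; lra.
(* The constant test function makes the two class means of the predictor opposite; any index serves,
   and [n > 0] provides one. *)
have AA' : A' = - A by have := E (Ordinal n0) 1 0; rewrite -/A -/A'; lra.
have Ej j : b j = ((1 - 2 * eta) - A) / 2 * fisher p p' j.
  have := E j 0 1; rewrite AA' mulr0 add0r mul1r => Ej.
  have -> : b j = (avg_var p p' j * b j) / avg_var p p' j by field; rewrite gt_eqF.
  rewrite /fisher mulrA; congr (_ / _); lra.
set t := ((1 - 2 * eta) - A) / 2 in Ej.
have AS : 2 * A = t * signal p p'.
  have -> : 2 * A = A - A' by rewrite AA'; ring.
  rewrite /A /A' /lbase opprD addrACA subrr add0r -sumrB /signal mulr_sumr.
  by apply: eq_bigr => i _; rewrite Ej; ring.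
have S0 : 0 <= signal p p'.
  apply: sumr_ge0 => i _; rewrite /fisher mulrAC -expr2 divr_ge0 ?sqr_ge0 //; exact: ltW.
(* Substituting [A = t * signal / 2] into the definition of [t] gives a linear equation for [t],
   with positive right side because [eta < 1 / 2]. *)
have t0 : 0 < t.
  have h : t * (1 + signal p p' / 4) = (1 - 2 * eta) / 2 by rewrite /t in AS *; lra.
  have h1 : 0 < 1 + signal p p' / 4 by lra.
  rewrite -(pmulr_lgt0 _ h1) h; lra.
have C q x : clin R n b q x = t * clin R n (fisher p p') q x.
  by rewrite /clin mulr_sumr; apply: eq_bigr => i _; rewrite Ej -mulrA.
exists t; split => // x.
  by rewrite (lin_predE b0 b p) C -/A; lra.
by rewrite (lin_predE b0 b p') C -/A' AA'; lra.
Qed.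

End NormalEquations.

(** * High-entropy samples *)

Section SignRespecting.
Local Open Scope classical_set_scope.
Local Open Scope ring_scope.
Variable R : realType.

Lemma compact_pos_bounds (T : topologicalType) (f : T -> R) (K : set T) :
  compact K -> {within K, continuous f} -> (forall x, K x -> 0 < f x) ->
  exists c C, 0 < c /\ forall x, K x -> c <= f x <= C.
Proof.
move=> cK cf f0; have [->|/set0P K0] := eqVneq K set0; first by exists 1, 1.
have [x1 /set_mem K1 h1] := compact_EVT_min K0 cK cf.
have [x2 _ h2] := compact_EVT_max K0 cK cf.
exists (f x1), (f x2); split; first exact: f0.
by move=> x /mem_set Kx; rewrite h1 // h2.
Qed.

Lemma compact_separated (e : R) (f : R * R -> R) : continuous f ->
  compact ((`[0, 1]%classic `*` `[0, 1]%classic) `&` [set qq : R * R | e <= f qq]).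
Proof.
move=> cf; apply: compact_closedI.
  by apply: compact_setX; exact: (@segment_compact R 0 1).
exact: (preimage_closed (fun x _ => cf x) (@closed_ge R e)).
Qed.

(** At distance at least [e] from the diagonal, [A_plus] and [A_minus] leave compact pieces on which
    [Lam] is bounded and bounded away from 0. The product with [q - q'] treats both signs at
    once. *)
Lemma sign_respecting_bounds (Lam : R -> R -> R) (e : R) :
  sign_respecting Lam -> 0 < e -> exists c C, [/\ 0 < c, 0 < C &
  forall q q', 0 <= q <= 1 -> 0 <= q' <= 1 -> e <= `|q - q'| ->
   `|Lam q q'| <= C /\ c * `|q - q'| <= (q - q') * Lam q q'].
Proof.
move=> [c1 c2 p1 p2] e0.
have cd : continuous (fun qq : R * R => qq.1 - qq.2).
  by move=> x; apply: cvgB; [exact: cvg_fst|exact: cvg_snd].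
have cd' : continuous (fun qq : R * R => qq.2 - qq.1).
  by move=> x; apply: cvgB; [exact: cvg_snd|exact: cvg_fst].
have [||a [A [a0 hA]]] := compact_pos_bounds _ (fun qq => Lam qq.1 qq.2) _ (compact_separated e _ cd).
- apply: continuous_subspaceW c1 => -[q q'] /= [[]]; rewrite !in_itv /= => h1 h2 h3.
  by split => //; split => //=; lra.
- move=> -[q q'] /= [[]]; rewrite !in_itv /= => h1 h2 h3; apply: (p1 (q, q')).
  by split => //; split => //=; lra.
have [||b [B [b0 hB]]] := compact_pos_bounds _ (fun qq => - Lam qq.1 qq.2) _ (compact_separated e _ cd').
- move=> x; apply: continuousN; move: x; apply: continuous_subspaceW c2 => -[q q'] /= [[]]; rewrite !in_itv /= => h1 h2 h3.
  by split => //; split => //=; lra.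
- move=> -[q q'] /= [[]]; rewrite !in_itv /= => h1 h2 h3.
  by have := p2 (q, q'); rewrite oppr_gt0; apply; split => //; split => //=; lra.
exists (Num.min a b), (Num.max 1 (Num.max A B)); split.
- by rewrite lt_min a0 b0.
- by rewrite lt_max ltr01.
move=> q q' hq hq' hqq; have [qq|qq] := leP 0 (q - q').
  rewrite ger0_norm // in hqq *.
  have /= /andP[h1 h2] : a <= Lam q q' <= A.
    by apply: (hA (q, q')); split => //=; split; rewrite /= in_itv.
  rewrite ger0_norm ?(le_trans (ltW a0)) // !le_max h2 !orbT; split => //.
  rewrite mulrC ler_wpM2l // ge_min h1 //.
rewrite ltr0_norm // in hqq *.
have /= /andP[h1 h2] : b <= - Lam q q' <= B.
  by apply: (hB (q, q')); split => /=; [split; rewrite /= in_itv|lra].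
have h3 : Num.min a b <= - Lam q q' by rewrite ge_min h1 orbT.
rewrite ltr0_norm; last by lra.
rewrite !le_max h2 !orbT; split => //.
have h4 : 0 <= - (q - q') by lra.
have := ler_wpM2l h4 h3; lra.
Qed.

End SignRespecting.

(** * Quantiles and the mass of bad high-entropy samples *)

Section Assembly.
Variable R : realType.

(** Among the outcomes outside the quantile set take one with the largest [V]: all the others lie in
    its lower level set, of mass below [1 - d]. The argument is insensitive to atoms. *)
Lemma upper_quantile_mass (T : finType) (m V : T -> R) (d : R) :
  (forall x, 0 <= m x) -> \sum_x m x = 1 -> d <= 1 ->
  d <= \sum_(x | 1 - d <= \sum_(y | V y <= V x) m y) m x.
Proof.
move=> m0 m1 d1.
pose B x := 1 - d <= \sum_(y | V y <= V x) m y.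
rewrite -[leRHS]/(\sum_(x | B x) m x); have [x0 hx0|hB] := pickP (fun x => ~~ B x); last first.
  rewrite (eq_bigl xpredT) ?m1 // => x; have := hB x; by case: (B x).
have : \sum_(x | ~~ B x) m x < 1 - d.
  case: (@Order.TotalTheory.arg_maxP _ _ _ x0 (fun x => ~~ B x) V hx0) => x1 hx1 h1.
  apply: (@le_lt_trans _ _ (\sum_(y | V y <= V x1) m y)); last by rewrite ltNge.
  rewrite [leLHS]big_mkcond [leRHS]big_mkcond; apply: ler_sum => x _.
  case: ifP => [Bx|_]; last by case: ifP.
  by rewrite (h1 x Bx : V x <= V x1).
rewrite -m1 [X in _ < X - d](bigID B) /=; lra.
Qed.

(** Contrapositive: if [clin v] at [x] is below [- (C / e) sqrt n], the lower level set of [x] is a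
    deviation event, of probability at most [e^2 <= e] by Chebyshev. *)
Lemma cdf_bern_small n (q v : 'I_n -> R) (C e : R) (x : {ffun 'I_n -> bool}) : is_prob R n q ->
  (0 < n)%N -> (forall i, `|v i| <= C) -> 0 < C -> 0 < e <= 1 ->
  e < cdf_bern q (fun y => \sum_i v i * sgnb R (y i)) (\sum_i v i * sgnb R (x i)) ->
  - (C / e * Num.sqrt n%:R) <= clin R n v q x.
Proof.
move=> hq n0 hv C0 /andP[e0 e1]; apply: contraLR; rewrite -ltNge -leNgt => hx.
have nE : (n%:R : R) = Num.sqrt n%:R ^+ 2 by rewrite sqr_sqrtr ?ler0n.
have r0 : 0 < Num.sqrt n%:R :> R by rewrite sqrtr_gt0 ltr0n.
have E (y : {ffun 'I_n -> bool}) : \sum_i v i * sgnb R (y i) = lbase R n 0 v q + clin R n v q y.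
  by have := lin_predE R n 0 v q y; rewrite /lin_pred add0r.
have k0 : 0 < C / e * Num.sqrt n%:R by rewrite mulr_gt0 // divr_gt0.
apply: (@le_trans _ _ (prob R n q (fun y => C / e * Num.sqrt n%:R <= `|clin R n v q y|))).
  apply: prob_sub => // y; rewrite !E lerD2l => hy.
  rewrite ltr0_norm; lra.
apply: (le_trans (@chebyshev_clin R n v q C _ hq hv k0)).
rewrite {1}nE; set r := Num.sqrt _ in r0 *.
have -> : C ^+ 2 * r ^+ 2 / (C / e * r) ^+ 2 = e * e by field; rewrite !gt_eqF.
by rewrite ler_piMr // ltW.
Qed.

(** Let [a] be the largest [|L|] on [B]. The depth [tau] given by [a = t * (S / 2 - tau * r)] serves
    both classes: [B] lies in the tail below [- (tau * r)], whereas the window at depth [tau] lies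
    in the set [|L| < a], of mass at most [d]. Tail domination then bounds the bad part of [B] by
    [k * d], to be compared with the mass at least [d] of [B] itself. *)
Lemma high_entropy_core n (p p' u u' v v' : 'I_n -> R)
    (e c C C' k k0 tau0 A d t S : R) (L h : {ffun 'I_n -> bool} -> R)
    (bad bad' : pred {ffun 'I_n -> bool}) :
  let r : R := Num.sqrt n%:R in
  let m x : R := (bern p x + bern p' x) / 2 in
  let B x := 1 - d <= \sum_(y | h y <= h x) m y in
  0 < e < 1 / 2 -> 0 < C -> 0 <= tau0 -> 0 < A -> 0 <= k ->
  tail_hyp R n e c C p u v -> tail_hyp R n e c C p' u' v' ->
  (forall x, `|L x| = t * `|S / 2 + clin R n u p x|) ->
  (forall x, `|L x| = t * `|S / 2 + clin R n u' p' x|) ->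
  (forall x y, `|L x| < `|L y| -> h y < h x) ->
  (forall x, bad x -> - (C' * r) <= clin R n v p x) ->
  (forall x, bad' x -> - (C' * r) <= clin R n v' p' x) ->
  k0 <= prob R n p (window R n p u tau0 (4 * C)) ->
  k0 <= prob R n p' (window R n p' u' tau0 (4 * C)) ->
  (forall tau, tau0 <= tau -> A * (tau + 1) <= r ->
    prob R n p (joint_tail R n p u v tau C') <= k * prob R n p (window R n p u tau (4 * C))) ->
  (forall tau, tau0 <= tau -> A * (tau + 1) <= r ->
    prob R n p' (joint_tail R n p' u' v' tau C') <= k * prob R n p' (window R n p' u' tau (4 * C))) ->
  0 < d -> d < k0 -> d <= 1 -> 0 < t -> (0 < n)%N ->
  A * (tau0 + C / d + 1) <= r -> (2 * (tau0 + C / d) + 4 * C) * r <= S ->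
  d <= (prob R n p B + prob R n p' B) / 2 /\
  (prob R n p (predI B bad) + prob R n p' (predI B bad')) / 2 <= k * d.
Proof.
move=> r m B he C0 tau00 A0 k_ge0 H H' hL hL' hanti hbad hbad' hk0 hk0' hdom hdom'
  d0 dk0 d1 t0 n0 hr hS.
have hp := tail_hyp_prob R n e c C p u v he H.
have hp' := tail_hyp_prob R n e c C p' u' v' he H'.
have r0 : 0 < r by rewrite sqrtr_gt0 ltr0n.
have nE : (n%:R : R) = r ^+ 2 by rewrite sqr_sqrtr ?ler0n.
have sumE (P : pred _) : \sum_(x | P x) m x = (prob R n p P + prob R n p' P) / 2.
  by rewrite /prob -big_split mulr_suml.
have total q : prob R n q xpredT = 1.
  rewrite -[RHS](expect_cst R n q); apply: eq_bigr => x _; by rewrite mulr1.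
have m0 x : 0 <= m x by rewrite divr_ge0 // addr_ge0 // bern_ge0.
have m1 : \sum_x m x = 1 by rewrite (sumE xpredT) !total; field.
have PB : d <= (prob R n p B + prob R n p' B) / 2.
  by rewrite -sumE; apply: upper_quantile_mass.
split => //.
have [x0 Bx0] : exists x, B x.
  apply/existsP; rewrite -[[exists _, _]]negbK negb_exists; apply/negP => /forallP hB.
  move: PB; rewrite /prob !big_pred0; first lra.
  - by move=> x; apply/negbTE.
  - by move=> x; apply/negbTE.
case: (@Order.TotalTheory.arg_maxP _ _ _ x0 B (fun x => `|L x|) Bx0) => w Bw hw.
pose a := `|L w|; rewrite -/a in hw.
(* Samples with [|L| < a] have strictly larger entropy than [w], and [w] belongs to [B], so at most
   mass [d] lies above it. *)
have Pa : (prob R n p (fun x => `|L x| < a) + prob R n p' (fun x => `|L x| < a)) / 2 <= d.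
  rewrite -sumE.
  have : \sum_(x | `|L x| < a) m x <= \sum_(x | ~~ (h x <= h w)) m x.
    rewrite [leLHS]big_mkcond [leRHS]big_mkcond; apply: ler_sum => x _.
    case: ifP => [/hanti|_]; last by case: ifP.
    by rewrite ltNge => ->.
  move: Bw; rewrite /B => Bw.
  have := m1; rewrite (bigID (fun x => h x <= h w)) /=; lra.
pose tau := (S / 2 - a / t) / r.
have aE : a = t * (S / 2 - tau * r) by rewrite /tau; field; rewrite !gt_eqF.
have BU (q w' : 'I_n -> R) x : (forall x, `|L x| = t * `|S / 2 + clin R n w' q x|) ->
    B x -> clin R n w' q x <= - (tau * r).
  move=> hl Bx; have := hw x Bx : `|L x| <= a; rewrite hl aE ler_pM2l // => h1.
  have := le_trans (ler_norm _) h1; lra.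
(* By [hS], [S / 2 + clin] stays above [- (S / 2 - tau * r)] on the whole window, so only the upper
   end of the window decides. *)
have win (q w' : 'I_n -> R) s x : (forall x, `|L x| = t * `|S / 2 + clin R n w' q x|) ->
    tau <= s -> s <= tau0 + C / d -> window R n q w' s (4 * C) x -> `|L x| < a.
  move=> hl ts sm /andP[]; rewrite -/r => x1 x2; rewrite hl aE ltr_pM2l // ltr_norml.
  have h1 : tau * r <= s * r by rewrite ler_pM2r.
  have h2 : s * r <= (tau0 + C / d) * r by rewrite ler_pM2r.
  by apply/andP; split; lra.
have Cd0 : 0 < C / d by rewrite divr_gt0.
(* Otherwise [{|L| < a}] would contain a window of mass at least [k0 > d]. *)
have tau_lo : tau0 <= tau.
  rewrite leNgt; apply/negP => htau.
  have h1 : prob R n p (window R n p u tau0 (4 * C)) <= prob R n p (fun x => `|L x| < a).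
    by apply: prob_sub => // x; apply: win hL _ _; lra.
  have h2 : prob R n p' (window R n p' u' tau0 (4 * C)) <= prob R n p' (fun x => `|L x| < a).
    by apply: prob_sub => // x; apply: win hL' _ _; lra.
  lra.
(* Otherwise Chebyshev would give [B] mass less than [d]. *)
have tau_hi : tau <= tau0 + C / d.
  rewrite leNgt; apply/negP => htau.
  have tau1 : C / d < tau by lra.
  have tau_gt0 : 0 < tau by lra.
  have ch (q w' v0 : 'I_n -> R) : is_prob R n q -> tail_hyp R n e c C q w' v0 ->
      (forall x, `|L x| = t * `|S / 2 + clin R n w' q x|) -> prob R n q B < d.
    move=> hq Hq hl.
    apply: (@le_lt_trans _ _ (prob R n q (fun x => tau * r <= `|clin R n w' q x|))).
      apply: prob_sub => // x /(BU q w' x hl) hx.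
      by rewrite ler0_norm; [lra|apply: (le_trans hx); rewrite oppr_le0 mulr_ge0 // ltW].
    apply: (le_lt_trans (@chebyshev_clin R n w' q C _ hq _ _)).
    - by move=> i; have [] := Hq i.
    - by rewrite mulr_gt0.
    rewrite nE.
    have -> : C ^+ 2 * r ^+ 2 / (tau * r) ^+ 2 = (C / tau) ^+ 2 by field; rewrite !gt_eqF.
    have h1 : C / tau < d by rewrite ltr_pdivrMr // mulrC -ltr_pdivrMr.
    have h2 : 0 < C / tau by rewrite divr_gt0.
    nra.
  have := ch _ _ _ hp H hL; have := ch _ _ _ hp' H' hL'; lra.
have hrt : A * (tau + 1) <= r by apply: le_trans hr; rewrite ler_pM2l //; lra.
have fin (q w' v0 : 'I_n -> R) (bd : pred _) : is_prob R n q ->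
    (forall x, `|L x| = t * `|S / 2 + clin R n w' q x|) ->
    (forall x, bd x -> - (C' * r) <= clin R n v0 q x) ->
    prob R n q (joint_tail R n q w' v0 tau C') <= k * prob R n q (window R n q w' tau (4 * C)) ->
    prob R n q (predI B bd) <= k * prob R n q (fun x => `|L x| < a).
  move=> hq hl hb hd.
  apply: (@le_trans _ _ (prob R n q (joint_tail R n q w' v0 tau C'))).
    by apply: prob_sub => // x /andP[/(BU q w' x hl) x1 /hb x2]; apply/andP; split.
  apply: (le_trans hd); apply: ler_wpM2l => //.
  by apply: prob_sub => // x; apply: win hl _ _.
have := fin _ _ _ _ hp hL hbad (hdom _ tau_lo hrt).
have := fin _ _ _ _ hp' hL' hbad' (hdom' _ tau_lo hrt).
have := ler_wpM2l k_ge0 Pa; lra.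
Qed.

End Assembly.

(** * Bounds on the discriminant weights *)

Section ToyFeatures.
Variables (R : realType) (n : nat).
Implicit Types (p : 'I_n -> R) (e : R).

Lemma avg_var_bounds p p' e i : 0 < e < 1 / 2 ->
  e <= p i <= 1 - e -> e <= p' i <= 1 - e -> 2 * e <= avg_var R n p p' i <= 1.
Proof.
move=> /andP[e0 e1] /andP[a1 a2] /andP[b1 b2]; rewrite /avg_var.
have := sqr_ge0 (2 * p i - 1); have := sqr_ge0 (2 * p' i - 1).
have : e / 2 <= p i * (1 - p i) by nra.
have : e / 2 <= p' i * (1 - p' i) by nra.
by move=> h1 h2 h3 h4; apply/andP; split; lra.
Qed.

Lemma avg_varC p p' i : avg_var R n p' p i = avg_var R n p p' i.
Proof. by rewrite /avg_var; ring. Qed.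

Lemma clin_fisherC p p' q x :
  clin R n (fisher R n p' p) q x = - clin R n (fisher R n p p') q x.
Proof.
by rewrite /clin -sumrN; apply: eq_bigr => i _; rewrite /fisher avg_varC; ring.
Qed.

Lemma signal_ge p p' e : 0 < e < 1 / 2 ->
  (forall i, e <= p i <= 1 - e) -> (forall i, e <= p' i <= 1 - e) ->
  (forall i, e <= `|p i - p' i|) -> 4 * e ^+ 2 * n%:R <= signal R n p p'.
Proof.
move=> he hp hp' hd; have /andP[e0 e1] := he.
rewrite mulrC; apply: sumr_ge_cst => i.
have /andP[D0 D1] := avg_var_bounds p p' e i he (hp i) (hp' i).
have d2 : e ^+ 2 <= (p i - p' i) ^+ 2.
  by rewrite -[leRHS]real_normK ?num_real // lerXn2r ?nnegrE // ltW.
have -> : fisher R n p p' i * (2 * (p i - p' i)) = 4 * (p i - p' i) ^+ 2 / avg_var R n p p' i.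
  by rewrite /fisher; field; rewrite gt_eqF //; lra.
rewrite ler_pdivlMr; last lra.
have := sqr_ge0 e; nra.
Qed.

(** [Lam (p i) (p' i)] and the [fisher] weight both have the sign of [p i - p' i]. The lower bounds
    use [avg_var <= 1], and the bound [e^-1] on the weights uses [avg_var >= 2 * e]. *)
Lemma tail_hyp_fisher Lam p p' e (c C : R) : 0 < e < 1 / 2 -> 0 < c -> 0 < C ->
  (forall i, e <= p i <= 1 - e) -> (forall i, e <= p' i <= 1 - e) ->
  (forall i, e <= `|p i - p' i|) ->
  (forall q q', 0 <= q <= 1 -> 0 <= q' <= 1 -> e <= `|q - q'| ->
   `|Lam q q'| <= C /\ c * `|q - q'| <= (q - q') * Lam q q') ->
  tail_hyp R n e (Num.min (4 * e ^+ 2) (2 * e * c)) (e^-1 + C) p (fisher R n p p')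
    (fun i => Lam (p i) (p' i)).
Proof.
move=> he c0 C0 hp hp' hd hL i; have /andP[e0 e1] := he.
have /andP[D0 D1] := avg_var_bounds p p' e i he (hp i) (hp' i).
have Dgt0 : 0 < avg_var R n p p' i by lra.
have [||L1 L2] := hL (p i) (p' i) _ _ (hd i).
- by have /andP[a b] := hp i; apply/andP; split; lra.
- by have /andP[a b] := hp' i; apply/andP; split; lra.
have d2 : e ^+ 2 <= (p i - p' i) ^+ 2.
  by rewrite -[leRHS]real_normK ?num_real // lerXn2r ?nnegrE // ltW.
have ei : 0 < e^-1 by rewrite invr_gt0.
split; first exact: hp.
- rewrite /fisher normrM normfV normrM (gtr0_norm Dgt0) ger0_norm // ler_pdivrMr //.
  have d1 : `|p i - p' i| <= 1.
    have /andP[? ?] := hp i; have /andP[? ?] := hp' i.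
    by rewrite ler_norml; apply/andP; split; lra.
  have h1 : 2 <= e^-1 * avg_var R n p p' i.
    have -> : 2 = e^-1 * (2 * e) :> R by field; rewrite gt_eqF.
    by rewrite ler_pM2l.
  have h2 : 0 <= C * avg_var R n p p' i by rewrite mulr_ge0 // ltW.
  lra.
- by rewrite (le_trans L1) // lerDr ltW.
- rewrite ge_min; apply/orP; left.
  rewrite /fisher expr_div_n ler_pdivlMr ?exprn_gt0 //.
  have : avg_var R n p p' i ^+ 2 <= 1 by rewrite expr_le1 // ltW.
  have := sqr_ge0 e; have := sqr_ge0 (avg_var R n p p' i); nra.
rewrite ge_min; apply/orP; right.
rewrite /fisher [leRHS]mulrAC ler_pdivlMr //.
have h1 : c * e <= c * `|p i - p' i| by rewrite ler_pM2l.
have h2 : 0 <= 2 * e * c by rewrite !mulr_ge0 // ltW.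
have h3 := ler_wpM2l h2 D1.
lra.
Qed.

End ToyFeatures.

(** * Choice of constants and the conditional probability *)

Theorem theorem1 (R : realType) (Lam : R -> R -> R) (eps : R) :
  sign_respecting Lam -> 0 < eps < 1 / 2 ->
  exists2 delta0 : R, 0 < delta0 &
  forall delta : R, 0 < delta <= delta0 ->
  exists N : nat, forall n : nat, (N <= n)%N ->
  forall (eta : R) (p p' : 'I_n -> R),
    0 <= eta < 1 / 2 ->
    (forall i, eps <= p i <= 1 - eps) ->
    (forall i, eps <= p' i <= 1 - eps) ->
    (forall i, eps <= `|p i - p' i|) ->
  forall (b0 : R) (b : 'I_n -> R), is_risk_minimizer eta p p' b0 b ->
    let H := fun w : omega n => entropy_fun b0 b w.1.1 in
    1 - eps <= toy_cond eta p p'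
                 (fun w => R_score Lam p p' w.1.1 w.2 <= eps)
                 (fun w => 1 - delta <= cdf_toy eta p p' H (H w)).
Proof.
move=> hLam he; have /andP[e0 e1] := he.
have [c1 [C1 [c10 C10 hL]]] := sign_respecting_bounds R Lam eps hLam e0.
pose c := Num.min (4 * eps ^+ 2) (2 * eps * c1).
pose C := eps^-1 + C1.
have e20 : 0 < eps ^+ 2 by apply: exprn_gt0.
have c0 : 0 < c by rewrite /c lt_min; apply/andP; split; rewrite !mulr_gt0.
have ei : 0 < eps^-1 by rewrite invr_gt0.
have C0 : 0 < C by rewrite /C; lra.
have Ce0 : 0 <= C / eps by rewrite divr_ge0 // ltW.
(* [C / eps] is the threshold of [cdf_bern_small]; the domination ratio [eps] becomes the bound on
   the conditional probability of failure. *)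
have [tau0 [A [k0 [tau00 A0 k00 hdom]]]] :=
  tail_domination R eps c C (C / eps) eps he c0 C0 Ce0 e0.
(* These two bounds provide [d <= 1] and the strict [d < k0]. *)
exists (Num.min 1 (k0 / 2)); first by rewrite lt_min ltr01 divr_gt0.
move=> d /andP[d0]; rewrite le_min => /andP[d1 dk].
have Cd0 : 0 < C / d by rewrite divr_gt0.
(* The first entry permits tail domination at all depths up to [tau0 + C / d]; the second, with
   [signal_ge], makes the signal exceed twice that depth plus the window width. *)
pose r0 := Num.max (A * (tau0 + C / d + 1)) ((2 * (tau0 + C / d) + 4 * C) / (4 * eps ^+ 2)).
(* [Num.bound] ensures [r0 ^+ 2 <= n], and the successor ensures [n > 0]. *)
exists (Num.bound (r0 ^+ 2)).+1 => n hn eta p p' /andP[_ heta] hp hp' hd b0 b hmin.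
lazy zeta; set H := fun w : omega n => entropy_fun b0 b w.1.1.
have n0 : (0 < n)%N by apply: leq_trans hn.
have rr0 : r0 <= Num.sqrt n%:R.
  apply: le_trans (ler_norm _) _; rewrite -sqrtr_sqr ler_wsqrtr //.
  apply: le_trans (ltW (archi_boundP (sqr_ge0 _))) _.
  by rewrite ler_nat ltnW.
have rgt0 : 0 < Num.sqrt n%:R :> R by rewrite sqrtr_gt0 ltr0n.
have nE : (n%:R : R) = Num.sqrt n%:R ^+ 2 by rewrite sqr_sqrtr ?ler0n.
move: rr0; rewrite /r0 ge_max => /andP[hr1 hr2].
have hd' i : eps <= `|p' i - p i| by rewrite distrC.
have T := tail_hyp_fisher R n Lam p p' eps c1 C1 he c10 C10 hp hp' hd hL.
have T' := tail_hyp_fisher R n Lam p' p eps c1 C1 he c10 C10 hp' hp hd' hL.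
rewrite -/c -/C in T T'.
have hQ := tail_hyp_prob R n eps c C p _ _ he T.
have hQ' := tail_hyp_prob R n eps c C p' _ _ he T'.
have hD i : 0 < avg_var R n p p' i.
  by have /andP[h1 _] := avg_var_bounds R n p p' eps i he (hp i) (hp' i); lra.
have [t [t0 hl hl']] := risk_min_lin_pred R n eta p p' b0 b heta hD hmin n0.
have [D0 D] := hdom n p _ _ n0 T.
have [D0' D'] := hdom n p' _ _ n0 T'.
have hr3 : A * (tau0 + 1) <= Num.sqrt n%:R.
  by apply: le_trans hr1; rewrite ler_pM2l //; lra.
have hS : (2 * (tau0 + C / d) + 4 * C) * Num.sqrt n%:R <= signal R n p p'.
  apply: le_trans (signal_ge R n p p' eps he hp hp' hd).
  move: nE rgt0 hr2; set r := Num.sqrt n%:R => -> rgt0 hr2.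
  rewrite [r ^+ 2]expr2 [leRHS]mulrA ler_pM2r //.
  by rewrite [leRHS]mulrC -ler_pdivrMr ?mulr_gt0 //.
pose bad x := eps < cdf_bern p (Psi Lam p p') (Psi Lam p p' x).
pose bad' x := eps < cdf_bern p' (Psi Lam p' p) (Psi Lam p' p x).
have eps01 : 0 < eps <= 1 by apply/andP; split; lra.
have [||||||hB hbad] := high_entropy_core R n p p' _ _ _ _ eps c C (C / eps) eps k0 tau0 A d t
  (signal R n p p') (lin_pred b0 b) (entropy_fun b0 b) bad bad' he C0 tau00 A0 (ltW e0) T T'
  _ _ _ _ _ (D0 hr3) (D0' hr3) D D' d0 _ d1 t0 n0 hr1 hS.
- by move=> x; rewrite hl normrM gtr0_norm.
(* Exchanging the classes negates the [fisher] weights; the absolute value absorbs this sign, so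
   both classes take the same form. *)
- move=> x; rewrite hl' normrM gtr0_norm // clin_fisherC; congr (_ * _).
  by rewrite -opprD normrN.
- by move=> x y; apply: bin_entropy_sigmoid_lt.
- move=> x; apply: (cdf_bern_small R n p _ C eps x hQ n0 _ C0 eps01) => i.
  by have [] := T i.
- move=> x; apply: (cdf_bern_small R n p' _ C eps x hQ' n0 _ C0 eps01) => i.
  by have [] := T' i.
- lra.
pose B x := 1 - d <= \sum_(y | entropy_fun b0 b y <= entropy_fun b0 b x) (bern p y + bern p' y) / 2.
rewrite -/(prob R n p B) in hB hbad.
have BE (w : omega n) : (1 - d <= cdf_toy eta p p' H (H w)) = B w.1.1.
  congr (_ <= _); rewrite /cdf_toy.
  rewrite (toy_prob_xz R n eta p p' (fun x z => entropy_fun b0 b x <= H w)).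
  by rewrite /prob -big_split -mulr_suml.
rewrite /toy_cond.
have -> : toy_prob eta p p' (fun w => 1 - d <= cdf_toy eta p p' H (H w)) =
    (prob R n p B + prob R n p' B) / 2.
  rewrite -(toy_prob_xz R n eta p p' (fun x z => B x)).
  by apply: eq_bigl => w; apply: BE.
have -> : toy_prob eta p p' (predI (fun w => R_score Lam p p' w.1.1 w.2 <= eps)
     (fun w => 1 - d <= cdf_toy eta p p' H (H w))) =
    (prob R n p (fun x => ~~ bad x && B x) + prob R n p' (fun x => ~~ bad' x && B x)) / 2.
  rewrite -(toy_prob_xz R n eta p p' (fun x z => (if z then ~~ bad x else ~~ bad' x) && B x)).
  apply: eq_bigl => w; rewrite /= BE /R_score; congr (_ && _).
  by case: w.2; rewrite -leNgt.
have split_bad q (bd : pred _) : prob R n q B =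
    prob R n q (predI B bd) + prob R n q (fun x => ~~ bd x && B x).
  rewrite /prob (bigID bd) /=; congr (_ + _).
  by apply: eq_bigl => x; rewrite andbC.
(* The conditioning event has positive mass, so the quotient can be cleared. *)
have hB0 : 0 < (prob R n p B + prob R n p' B) / 2 by apply: lt_le_trans hB.
rewrite ler_pdivlMr //.
have h1 := split_bad p bad; have h2 := split_bad p' bad'.
have h3 := ler_wpM2l (ltW e0) hB.
lra.
Qed.
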